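(* Let $\mathfrak g$ be a complex simple Lie algebra and let $z\in\mathfrak t_{\mathbb Q}$ be such that $\gamma(z)\in\{-1,0,1,2\}$ for all $\gamma\in\Delta^+$. Then $w_z(z)\in-\mathcal C$, i.e., $w_z(z)$ is anti-dominant. Moreover, $w_z$ is the unique element of minimal length in $W$ that takes $z$ into $-\mathcal C$.
   Context: Let $\mathfrak t$ be a Cartan subalgebra of $\mathfrak g$, $\Delta$ the root system, $\Delta^+$ a fixed set of positive roots, $\Delta^-=-\Delta^+$, $\Pi$ the simple roots, $W$ the Weyl group, $\mathfrak t_{\mathbb Q}\subset\mathfrak t$ the rational form on which all roots take rational values. The dominant Weyl chamber is $\mathcal C=\{x\in\mathfrak t_{\mathbb Q}\mid\alpha(x)\ge0\ \ \forall\alpha\in\Pi\}$. For $z$ as in the claim put $\Delta^+_z(i)=\{\gamma\in\Delta^+\mid\gamma(z)=i\}$. There is a unique $w_z\in W$ with inversion set $\{\gamma\in\Delta^+\mid w_z(\gamma)\in\Delta^-\}=\Delta^+_z(1)\sqcup\Delta^+_z(2)$. Length is taken with respect to the simple reflections. *)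

(* Defs.v *)
From mathcomp Require Import all_boot all_order all_algebra.
From mathcomp Require Import boolp classical_sets reals.
From mathcomp Require Export complex.

Set Implicit Arguments.
Unset Strict Implicit.
Unset Printing Implicit Defensive.

Import Order.TTheory GRing.Theory Num.Theory.
Local Open Scope ring_scope.
Local Open Scope classical_set_scope.

(* Finite-dimensional Lie algebras; the bracket [x, y] is [ad x y], bilinear
   because [ad] is a linear map into endomorphisms. *)
Record lieAlgebra (F : fieldType) := LieAlgebra {
  lie_sort :> vectType F;
  ad : 'Hom(lie_sort, 'End(lie_sort));
  lie_alternating : forall x, ad x x = 0;
  lie_jacobi : forall x y z,
    ad x (ad y z) + ad y (ad z x) + ad z (ad x y) = 0 }.

Arguments ad {F g} : rename.

Section LieAlgebras.
Variables (F : fieldType) (g : lieAlgebra F).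
Implicit Types (x y : g) (U : {vspace g}).

Definition lie_ideal U := forall x y, y \in U -> ad x y \in U.

Definition lie_simple :=
  (exists x y, ad x y != 0) /\
  (forall U, lie_ideal U -> U = 0%VS \/ U = fullv).

Definition endo_trace (V : vectType F) (f : 'End(V)) : F :=
  \tr (passmx.mxof (vbasis fullv) (vbasis fullv) f).

Definition killing x y : F := endo_trace (ad x \o ad y)%VF.

Definition endo_diagonalizable (V : vectType F) (f : 'End(V)) :=
  exists2 b : seq V, basis_of fullv b &
    forall v, v \in b -> exists a : F, f v = a *: v.

(* The textbook notion for complex semisimple Lie algebras: a commutative
   subalgebra equal to its own centralizer, all of whose elements are
   ad-diagonalizable. *)
Definition cartan_subalgebra U :=
  [/\ forall x y, x \in U -> y \in U -> ad x y = 0,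
      forall x, (forall y, y \in U -> ad y x = 0) -> x \in U
    & forall x, x \in U -> endo_diagonalizable (ad x)].

End LieAlgebras.

Section RootSystem.
Variables (R : realType) (g : lieAlgebra R[i]) (t : {vspace g}).

Definition tdual := 'Hom(subvs_of t, R[i]^o).

Definition roots : set tdual := [set alpha : tdual | alpha != 0 /\
  exists2 x : g, x != 0 & forall h : subvs_of t, ad (vsval h) x = alpha h *: x].

Definition rational_form : set (subvs_of t) :=
  [set x : subvs_of t | forall alpha, roots alpha -> exists q : rat, alpha x = ratr q].

(* [s] is x |-> x - 2 alpha(x) / alpha(a) a, where [a] represents [alpha]
   through the Killing form, so that alpha(a) = killing a a. *)
Definition is_reflection (alpha : tdual) (s : 'End(subvs_of t)) :=
  exists2 a : subvs_of t,
    forall x : subvs_of t, killing (vsval a) (vsval x) = alpha x &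
    forall x : subvs_of t, s x = x - (2 * alpha x / alpha a) *: a.

(* The reflections are involutions, so products of them form a group. *)
Inductive weyl_group : set 'End(subvs_of t) :=
| weyl_one : weyl_group \1%VF
| weyl_mul alpha s w : roots alpha -> is_reflection alpha s ->
    weyl_group w -> weyl_group (s \o w)%VF.

(* The contragredient action on the dual; elements of the Weyl group are
   invertible, so [w^-1] is a genuine inverse for them. *)
Definition dual_act (w : 'End(subvs_of t)) (alpha : tdual) : tdual :=
  (alpha \o w^-1)%VF.

Variable P : set tdual.

Definition positive_system :=
  [/\ P `<=` roots,
      forall alpha, roots alpha -> (P alpha <-> ~ P (- alpha))
    & forall alpha beta, P alpha -> P beta -> roots (alpha + beta) ->
        P (alpha + beta)].

Definition negative_roots : set tdual := [set alpha : tdual | P (- alpha)].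

Definition simple_roots : set tdual :=
  [set alpha : tdual | P alpha /\
     ~ exists beta gamma, [/\ P beta, P gamma & alpha = beta + gamma]].

Definition dominant_chamber : set (subvs_of t) :=
  [set x : subvs_of t | rational_form x /\ forall alpha, simple_roots alpha -> 0 <= alpha x].

Definition antidominant (x : subvs_of t) := dominant_chamber (- x).

Inductive simple_word : nat -> 'End(subvs_of t) -> Prop :=
| simple_word_nil : simple_word 0 \1%VF
| simple_word_cons n alpha s w : simple_roots alpha -> is_reflection alpha s ->
    simple_word n w -> simple_word n.+1 (s \o w)%VF.

Definition has_length (w : 'End(subvs_of t)) (n : nat) :=
  simple_word n w /\ forall m, simple_word m w -> (n <= m)%N.

Definition inversion_set (w : 'End(subvs_of t)) : set tdual :=
  [set gamma : tdual | P gamma /\ negative_roots (dual_act w gamma)].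

Variable z : subvs_of t.

Definition level (i : R[i]) : set tdual := [set gamma : tdual | P gamma /\ gamma z = i].

Definition is_wz (w : 'End(subvs_of t)) :=
  weyl_group w /\ inversion_set w = level 1 `|` level 2.

Definition takes_antidominant (w : 'End(subvs_of t)) :=
  weyl_group w /\ antidominant (w z).

Definition minimal_antidominant (w : 'End(subvs_of t)) :=
  takes_antidominant w /\
  exists2 n, has_length w n &
    forall w' m, takes_antidominant w' -> has_length w' m -> (n <= m)%N.

End RootSystem.

(* Main.v *)
Require Import Defs.
From HB Require Import structures.
From mathcomp Require Import all_boot all_order all_algebra.
From mathcomp Require Import boolp classical_sets reals.
From mathcomp Require Import ring zify.

Import passmx Order.TTheory GRing.Theory Num.Theory.
Local Open Scope ring_scope.

Set Implicit Arguments.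
Unset Strict Implicit.
Unset Printing Implicit Defensive.

(** The element w is determined by its inversion set
    N(w) = {gamma > 0 | w gamma < 0}, and the values of the positive roots at z
    turn the inversion set prescribed by w_z into
    N_z = {gamma > 0 | gamma(z) > 0}.  Three observations then give the theorem.

    Existence.  If no positive root is positive at z, then w = 1.  Otherwise
    some simple root alpha is positive at z; as s_alpha permutes the positive
    roots other than alpha, it maps N_(s_alpha z) injectively into N_z minus
    alpha, so an element for s_alpha z is found by induction and
    composing it with s_alpha gives one for z ([exists_inversion_set]).

    Antidominance.  A simple root alpha evaluated at w z is the root
    beta = w^-1 alpha evaluated at z.  If beta is positive it is not inverted by
    w, so beta(z) <= 0; if it is negative, then -beta is inverted and
    beta(z) < 0 ([inversion_set_antidominant]).

    Minimality.  Any element w' taking z to an antidominant point inverts every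
    positive root which is positive at z, so N_z is contained in N(w').  The
    length of an element is the cardinal of its inversion set
    ([has_length_inversions]), so w is shortest, and an element of the same
    length has the same inversion set, hence is equal to w
    ([inversion_set_inj]).

    All this rests on the geometry of the root system, which has to be derived
    from the Lie algebra.  As the elements of t act by commuting diagonalizable
    endomorphisms, g has a basis of weight vectors, and the Killing form on t
    becomes the sum of the products of the weights.  The one computation needed
    is the classical formula for e f^(k+1) v, where v is killed by e
    ([eigen_chain]).  Applied to h = [e, f] with e, f of opposite weights alpha
    and -alpha, it shows that every weight is at h a rational multiple of
    alpha(h) ([weight_ratio]).  Since g has no centre, alpha(h) is nonzero as
    soon as h is, and then the Killing form at (h, h) is alpha(h)^2 times a
    positive rational; since g is not spanned by its root vectors, such an h
    exists.  The Killing form is therefore nonzero, and nondegenerate because its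
    radical is an ideal ([killing_nondegenerate]).  This provides the vectors
    representing the roots, their positivity ([represents_gt0]), and, by the same
    formula, unbroken root strings ([root_string]) and the absence of proper
    multiples of roots among the roots ([root_reduced]).

    For the combinatorial part, positive systems are only assumed closed, so
    the order gamma < beta when beta - gamma is a sum of positive roots has to be
    shown irreflexive ([positive_sum_neq0]).  Induction along it replaces the
    height function. *)

(** * Traces and simultaneous diagonalization *)

Section LinearAlgebra.
Variables (F : fieldType) (V : vectType F).
Implicit Types (f h : 'End(V)) (b : (\dim {:V}).-tuple V).

Lemma mxofE b (e : (\dim {:V}).-tuple V) f i j :
  mxof b e f i j = coord e j (f b`_i).
Proof. by rewrite !mxE /= vecof_delta. Qed.

(** The trace is defined through an arbitrary fixed basis; this change of
    basis lets it be read off in a basis of weight vectors. *)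
Lemma endo_trace_basis b f : basis_of fullv b ->
  endo_trace f = \sum_i coord b i (f b`_i).
Proof.
move=> bB; have vB := vbasisP {:V}.
have -> : \sum_i coord b i (f b`_i) = \tr (mxof b b f).
  by apply: eq_bigr => i _; rewrite mxofE.
rewrite /endo_trace.
(* Conjugating by the identity exhibits the base change matrices. *)
have fE : f = (\1 \o (f \o \1))%VF by rewrite comp_lfun1l comp_lfun1r.
rewrite [in RHS]fE (mxof_comp _ _ vB) (mxof_comp _ _ vB).
rewrite -mulmxA mxtrace_mulC -mulmxA -(mxof_comp _ _ bB).
rewrite comp_lfun1l.
by rewrite mxof1 ?(basis_free vB)// mulmx1.
Qed.

Lemma endo_traceC f h : endo_trace (f \o h)%VF = endo_trace (h \o f)%VF.
Proof.
have vB := vbasisP {:V}.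
by rewrite /endo_trace !(mxof_comp _ _ vB) mxtrace_mulC.
Qed.

Lemma endo_traceB f h : endo_trace (f - h) = endo_trace f - endo_trace h.
Proof. by rewrite /endo_trace !linearB. Qed.

Lemma endo_traceP a f h : endo_trace (a *: f + h) = a * endo_trace f + endo_trace h.
Proof. by rewrite /endo_trace !linearP. Qed.

Lemma basis_unitmx b (e : (\dim {:V}).-tuple V) :
  basis_of fullv b -> basis_of fullv e -> mxof b e \1 \in unitmx.
Proof.
move=> bB eB; apply: (proj1 (@mulmx1_unit _ _ _ (mxof e b \1) _)).
rewrite -(mxof_comp _ _ eB) comp_lfun1l.
by rewrite mxof1 ?(basis_free bB).
Qed.

Lemma endo_diagonalizableW f (e : (\dim {:V}).-tuple V) : basis_of fullv e ->
  endo_diagonalizable f -> diagonalizable (mxof e e f).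
Proof.
move=> eB [b' bB bf].
have sb : size b' == \dim {:V}.
  by case/andP: bB => /eqP <- /eqP ->.
pose b := Tuple sb.
have {}bB : basis_of fullv b by [].
exists (mxof b e \1); first exact: basis_unitmx.
have bf' (i : 'I_(\dim {:V})) : {a | f b`_i = a *: b`_i}.
  by apply: cid; apply: bf; apply: mem_nth; rewrite (eqP sb).
apply/diagonalizable_forPex; exists (\row_i sval (bf' i)).
apply/simmxP; first exact: basis_unitmx.
rewrite -(mxof_comp _ _ eB) comp_lfun1r.
apply/matrixP => i j; rewrite mul_diag_mx mxofE mxE mxE mxofE lfunE /=.
by case: (bf' i) => a /= ->; rewrite linearZ.
Qed.

(** Translation to linear maps of the codiagonalization of a commuting family
    of diagonalizable matrices: the rows of the diagonalizing matrix are the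
    coordinates of the eigenvectors. *)
Lemma simultaneous_eigenbasis (fs : seq 'End(V)) :
  {in fs &, forall f h, (f \o h = h \o f)%VF} ->
  {in fs, forall f, endo_diagonalizable f} ->
  exists2 b : (\dim {:V}).-tuple V, basis_of fullv b &
    {in fs, forall f, forall i : 'I_(\dim {:V}), exists a, f b`_i = a *: b`_i}.
Proof.
move=> fC fD; pose e := vbasis {:V}; have eB : basis_of fullv e := vbasisP _.
have [|P Pu /allP PD] :=
    (codiagonalizableP [seq mxof e e f | f <- fs]).1.
  split=> [_ _ /mapP[f ff ->] /mapP[h hh ->]|_ /mapP[f ff ->]].
    by rewrite /comm_mx -!(mxof_comp _ _ eB) fC.
  exact: endo_diagonalizableW (fD _ ff).
have [b bE] : exists b : (\dim {:V}).-tuple V,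
    forall i : 'I_(\dim {:V}), b`_i = vecof e (row i P).
  pose w i := vecof e (row i P); have szw : size (codom w) == \dim {:V}.
    by rewrite size_codom card_ord.
  by exists (Tuple szw) => i; rewrite (nth_map i) ?size_enum_ord // nth_ord_enum.
exists b.
  rewrite basisEfree size_tuple leqnn subvf andbT /= andbT.
  apply/freeP => k k0 i.
  have : (\row_i k i) *m P = 0.
    apply/eqP; rewrite -(vecof_eq0 eB); apply/eqP.
    rewrite mulmx_sum_row linear_sum -[RHS]k0; apply: eq_bigr => j _.
    by rewrite linearZ /= mxE bE.
  move/(congr1 (mulmx^~ (invmx P))); rewrite mulmxK // mul0mx => /rowP/(_ i).
  by rewrite !mxE.
move=> f ff i.
have /diagonalizable_forPex[D /(simmxP Pu) PfD] := PD _ (map_f _ ff).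
exists (D 0 i); rewrite bE (hom_vecof _ eB) -row_mul PfD.
by rewrite row_mul row_diag_mx -scalemxAl -rowE linearZ.
Qed.

End LinearAlgebra.

(** * The adjoint action and weight vectors *)

(** Packages a function known to be linear only propositionally. *)
Lemma lfun_of_linear (F : fieldType) (U V : vectType F) (f : U -> V) :
  linear f -> exists phi : 'Hom(U, V), forall x, phi x = f x.
Proof.
move=> f_lin; pose m := GRing.isLinear.Build F U V _ f f_lin.
pose fL : {linear U -> V} := HB.pack f m.
by exists (linfun fL) => x; rewrite lfunE.
Qed.

Lemma lfunMnE (F : fieldType) (U V : vectType F) (f : 'Hom(U, V)) n x :
  (f *+ n) x = f x *+ n.
Proof. by elim: n => [|n IH]; rewrite ?zero_lfunE // !mulrS add_lfunE IH. Qed.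

Section LieTheory.
Variables (F : fieldType) (g : lieAlgebra F).
Implicit Types (x y z : g).

Lemma adZl a x y : ad (a *: x) y = a *: ad x y.
Proof. by rewrite linearZ !lfun_simp. Qed.

Lemma adC x y : ad x y = - ad y x.
Proof.
apply/eqP; rewrite -addr_eq0; apply/eqP.
have := lie_alternating (x + y); rewrite !linearD /= !lfun_simp.
by rewrite !lie_alternating add0r addr0 addrC.
Qed.

Lemma ad_adE x y : ad (ad x y) = ((ad x \o ad y) - (ad y \o ad x))%VF.
Proof.
apply/lfunP => z; rewrite !lfun_simp adC.
have /eqP := lie_jacobi x y z; rewrite addrC addr_eq0 => /eqP ->.
by rewrite [ad z x]adC (linearN (ad y)) opprK.
Qed.

Lemma ad_jacobi x y z : ad x (ad y z) = ad (ad x y) z + ad y (ad x z).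
Proof. by rewrite ad_adE !lfun_simp subrK. Qed.

Lemma killingC x y : killing x y = killing y x.
Proof. exact: endo_traceC. Qed.

Lemma killingPl a x y z : killing (a *: x + y) z = a * killing x z + killing y z.
Proof.
rewrite /killing linearP /= -endo_traceP; congr endo_trace.
by apply/lfunP => v; rewrite !lfun_simp.
Qed.

Lemma killingZl a x y : killing (a *: x) y = a * killing x y.
Proof.
have k0 z : killing 0 z = 0.
  by have := killingPl (-1) 0 0 z; rewrite scaler0 addr0 mulN1r addNr.
by rewrite -[a *: x]addr0 killingPl k0 addr0.
Qed.

Lemma killing_Zr a x y : killing x (a *: y) = a * killing x y.
Proof. by rewrite killingC killingZl killingC. Qed.

Lemma killingDr x y z : killing x (y + z) = killing x y + killing x z.
Proof.
by rewrite killingC -[y]scale1r killingPl mul1r scale1r !(killingC x).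
Qed.

(** The two sides are traces of x y z - y x z and x y z - x z y, and y (x z)
    and (x z) y have the same trace. *)
Lemma killing_invariant x y z : killing (ad x y) z = killing x (ad y z).
Proof.
rewrite /killing !ad_adE.
have -> : (((ad x \o ad y) - (ad y \o ad x)) \o ad z =
  ((ad x \o ad y) \o ad z) - (ad y \o (ad x \o ad z)))%VF.
  by apply/lfunP => v; rewrite !lfun_simp.
have -> : (ad x \o ((ad y \o ad z) - (ad z \o ad y)) =
  ((ad x \o ad y) \o ad z) - ((ad x \o ad z) \o ad y))%VF.
  by apply/lfunP => v; rewrite !lfun_simp linearB.
by rewrite !endo_traceB; congr (_ - _); rewrite endo_traceC.
Qed.

End LieTheory.

Section Weights.
Variables (F : numFieldType) (g : lieAlgebra F) (t : {vspace g}).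
Local Notation T := (subvs_of t).
Local Notation dual := 'Hom(T, F^o).
Implicit Types (x y e f v : g) (h : T) (alpha beta : dual).

Definition weight_vector beta x := forall h, ad (vsval h) x = beta h *: x.

Lemma weight_ad alpha beta x y : weight_vector alpha x -> weight_vector beta y ->
  weight_vector (alpha + beta) (ad x y).
Proof.
move=> xa yb h; rewrite ad_jacobi xa yb lfun_simp adZl linearZ /=.
by rewrite scalerDl.
Qed.

Lemma weight_iter alpha beta x y n :
  weight_vector alpha x -> weight_vector beta y ->
  weight_vector (beta + alpha *+ n) (iter n (ad x) y).
Proof.
move=> xa yb; elim: n => [|n IH]; first by rewrite addr0.
by rewrite iterS mulrSr addrA addrC; apply: weight_ad.
Qed.

Lemma weightZ a beta x : weight_vector beta x -> weight_vector beta (a *: x).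
Proof. by move=> xb h; rewrite linearZ /= xb !scalerA mulrC. Qed.

(** The sl2 computation, with h = [e, f] not normalized: moving e past f
    produces h, which acts on f^k v by beta(h) - k alpha(h), and these
    eigenvalues add up to the coefficient.  Allowing alpha(h) = 0 covers the
    Heisenberg case as well. *)
Lemma eigen_chain alpha beta e f h v k : vsval h = ad e f ->
  weight_vector alpha e -> weight_vector (- alpha) f ->
  weight_vector beta v -> ad e v = 0 ->
  ad e (iter k.+1 (ad f) v) =
    (k.+1%:R * (beta h - k%:R / 2 * alpha h)) *: iter k (ad f) v.
Proof.
move=> hE ea fa vb ev0; elim: k => [|k IH].
  rewrite /= ad_jacobi -hE vb ev0 linear0 addr0; congr (_ *: _); by ring.
rewrite iterS ad_jacobi -hE IH linearZ /= (weight_iter k.+1 fa vb) -scalerDl.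
congr (_ *: _); by rewrite add_lfunE lfunMnE opp_lfunE -mulr_natr; field.
Qed.

(** It is enough to diagonalize a basis of t simultaneously; the eigenvalues
    on a common eigenvector then depend linearly on the element of t. *)
Lemma weight_basis : cartan_subalgebra t ->
  exists (b : (\dim {:g}).-tuple g) (wt : 'I_(\dim {:g}) -> dual),
    basis_of fullv b /\ forall i, weight_vector (wt i) b`_i.
Proof.
move=> [tC _ tD].
have bt v : v \in vbasis t -> v \in t by apply: vbasis_mem.
have [_ _ /mapP[x xt ->] /mapP[y yt ->]|_ /mapP[x xt ->]|b bB bD] :=
    @simultaneous_eigenbasis F g [seq ad v | v <- vbasis t].
- apply/lfunP => v; rewrite !lfun_simp ad_jacobi (tC x y) ?bt //.
  by rewrite linear0 zero_lfunE add0r.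
- by apply: tD; apply: bt.
exists b.
pose c (i : 'I_(\dim {:g})) h : F^o := coord b i (ad (vsval h) b`_i).
have clin i : linear (c i).
  by move=> a h h'; rewrite /c linearP /= !lfun_simp linearP.
pose wt i : dual := sval (cid (lfun_of_linear (clin i))).
have wtE i h : wt i h = c i h by rewrite /wt; case: cid.
exists wt; split=> // i h; rewrite wtE /c.
have [a Ha] : exists a, ad (vsval h) b`_i = a *: b`_i.
  have [k kE] : exists k : 'I_(\dim t) -> F, vsval h = \sum_j k j *: (vbasis t)`_j.
    by eexists; apply: (coord_basis (vbasisP t)); apply: subvsP.
  have bD' (j : 'I_(\dim t)) : exists a, ad (vbasis t)`_j b`_i = a *: b`_i.
    by apply: bD; apply/map_f/mem_nth; rewrite size_tuple.
  exists (\sum_j k j * sval (cid (bD' j))).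
  rewrite kE linear_sum sum_lfunE scaler_suml; apply: eq_bigr => j _.
  by rewrite linearZ lfun_simp; case: cid => a /= ->; rewrite scalerA.
by rewrite Ha linearZ /= coord_free ?(basis_free bB) // eqxx mulr1.
Qed.

End Weights.

(** * Weights in a simultaneous eigenbasis *)

Section WeightBasis.
Variables (F : numFieldType) (g : lieAlgebra F) (t : {vspace g}).
Local Notation T := (subvs_of t).
Local Notation dual := 'Hom(T, F^o).
Local Notation N := (\dim {:g}).
Variables (b : N.-tuple g) (wt : 'I_N -> dual).
Hypothesis bB : basis_of fullv b.
Hypothesis bw : forall i, weight_vector (wt i) b`_i.
Implicit Types (x y e f v : g) (h a : T) (alpha beta : dual).

Let bE x : x = \sum_i coord b i x *: b`_i.
Proof. by apply: coord_basis bB _; apply: memvf. Qed.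

(** Comparing coordinates in [h, x] = beta(h) x shows that x only involves
    basis vectors of weight beta. *)
Lemma coord_weight beta x i :
  weight_vector beta x -> coord b i x != 0 -> wt i = beta.
Proof.
move=> xb ci; apply/lfunP => h; apply: (mulIf ci).
have : coord b i (ad (vsval h) x) = coord b i (beta h *: x) by rewrite xb.
rewrite [x in ad _ x]bE linear_sum linearZ /= => <-.
rewrite (eq_bigr (fun j => (coord b j x * wt j h) *: b`_j)); last first.
  by move=> j _; rewrite linearZ /= bw scalerA.
by rewrite coord_sum_free ?(basis_free bB) // mulrC.
Qed.

Lemma weight_in_basis beta x :
  weight_vector beta x -> x != 0 -> exists i, wt i = beta.
Proof.
move=> xb x0; have [i ci] : exists i, coord b i x != 0.
  apply/existsP; apply: contraR x0; rewrite negb_exists => /forallP c0.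
  rewrite [x]bE big1 // => i _.
  by have := c0 i; rewrite negbK => /eqP ->; rewrite scale0r.
by exists i; apply: coord_weight xb ci.
Qed.

(** The vectors e^n x have pairwise different weights beta + n alpha, and only
    finitely many weights occur. *)
Lemma iter_weight_top alpha beta e x : alpha != 0 ->
  weight_vector alpha e -> weight_vector beta x -> x != 0 ->
  exists q, iter q (ad e) x != 0 /\ iter q.+1 (ad e) x = 0.
Proof.
move=> a0 ea xb x0.
have [n /eqP n0] : exists n, iter n (ad e) x == 0.
  apply: contrapT => /forallNP H.
  (* N + 1 different weights would have to fit into the N weights wt i. *)
  have H' (n : 'I_N.+1) : {i | wt i = beta + alpha *+ n}.
    apply: cid; apply: weight_in_basis (weight_iter n ea xb) _.
    by apply/negP/H.
  pose k n := sval (H' n).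
  suff /leq_card : injective k by rewrite !card_ord ltnn.
  move=> n m nm; have : wt (k n) = wt (k m) by rewrite nm.
  rewrite /k; case: (H' n) => _ /= ->; case: (H' m) => _ /= -> /addrI nmE.
  apply/val_inj/eqP; rewrite /= -(eqr_nat F).
  have [h ah] : exists h, alpha h != 0.
    apply: contrapT => /forallNP aN; case/eqP: a0; apply/lfunP => h.
    by rewrite zero_lfunE; apply/eqP; move: (aN h) => /negP; rewrite negbK.
  move/lfunP/(_ h): nmE; rewrite !lfunMnE -[LHS]mulr_natl -[RHS]mulr_natl.
  by move=> /(mulIf ah) ->; apply: eqxx.
have ex : exists n, iter n (ad e) x == 0 by exists n; apply/eqP.
case: (ex_minnP ex) => [[|q]] /eqP q0 qmin.
  by move: x0; rewrite (q0 : x = 0) eqxx.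
by exists q; split=> //; apply/negP => /qmin; rewrite ltnn.
Qed.

(** At the last nonzero f^k v, the coefficient in [eigen_chain] has to vanish,
    which forces beta(h) = (k / 2) alpha(h). *)
Lemma primitive_chain alpha beta e f h v : alpha != 0 -> vsval h = ad e f ->
  weight_vector alpha e -> weight_vector (- alpha) f ->
  weight_vector beta v -> v != 0 -> ad e v = 0 ->
  exists k : nat, beta h = k%:R / 2 * alpha h /\
    forall j, (j <= k)%N -> iter j (ad f) v != 0.
Proof.
move=> a0 hE ea fa vb v0 ev0.
have na0 : - alpha != 0 by rewrite oppr_eq0.
have [k [k0 k1]] := iter_weight_top na0 fa vb v0; exists k; split.
  have := eigen_chain k hE ea fa vb ev0; rewrite k1 linear0 => /esym/eqP.
  rewrite scaler_eq0 (negPf k0) orbF mulf_eq0 pnatr_eq0 /= subr_eq0.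
  by move/eqP.
move=> j /subnK jk; apply: contra k0 => /eqP j0; rewrite -jk iterD j0.
by elim: (k - j)%N => [|n IH] //=; rewrite (eqP IH) linear0.
Qed.

(** Raise a basis vector with e until it is killed, and apply [primitive_chain]
    to the result, whose weight differs by a multiple of alpha. *)
Lemma weight_ratio alpha e f h i : alpha != 0 -> vsval h = ad e f ->
  weight_vector alpha e -> weight_vector (- alpha) f ->
  exists r : rat, wt i h = ratr r * alpha h.
Proof.
move=> a0 hE ea fa; have b0 : b`_i != 0.
  apply/eqP => b0; have := coord_free i i (basis_free bB).
  by rewrite b0 linear0 eqxx => /esym/eqP; rewrite oner_eq0.
have [q [q0 q1]] := iter_weight_top a0 ea (bw i) b0.
have [k [kE _]] := primitive_chain a0 hE ea fa (weight_iter q ea (bw i)) q0 q1.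
exists (k%:R / 2 - q%:R); rewrite rmorphB /= fmorph_div !rmorph_nat mulrBl -kE.
by rewrite add_lfunE lfunMnE -[alpha h *+ q]mulr_natl addrK.
Qed.

Lemma killing_cartan h h' :
  killing (vsval h) (vsval h') = \sum_i wt i h * wt i h'.
Proof.
rewrite /killing (endo_trace_basis _ bB); apply: eq_bigr => i _.
rewrite comp_lfunE bw linearZ /= bw scalerA linearZ /=.
by rewrite coord_free ?(basis_free bB) // eqxx mulr1 mulrC.
Qed.

End WeightBasis.

(** * Nondegeneracy of the Killing form *)

Section SimpleStructure.
Variables (F : numFieldType) (g : lieAlgebra F) (t : {vspace g}).
Local Notation T := (subvs_of t).
Local Notation dual := 'Hom(T, F^o).
Local Notation N := (\dim {:g}).
Variables (b : N.-tuple g) (wt : 'I_N -> dual).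
Hypothesis bB : basis_of fullv b.
Hypothesis bw : forall i, weight_vector (wt i) b`_i.
Hypothesis gS : lie_simple g.
Hypothesis tC : cartan_subalgebra t.
Implicit Types (x y e f v u : g) (h a : T) (alpha beta : dual).

Let bE x : x = \sum_i coord b i x *: b`_i.
Proof. by apply: coord_basis bB _; apply: memvf. Qed.

(** A Cartan subalgebra is its own centralizer. *)
Lemma weight0_cartan x : weight_vector (0 : dual) x -> exists h, vsval h = x.
Proof.
move=> x0; have [_ tZ _] := tC.
have xt : x \in t.
  by apply: tZ => y yt; rewrite -(vsprojK yt) x0 zero_lfunE scale0r.
by exists (vsproj t x); rewrite vsprojK.
Qed.

Lemma centerless x : (forall y, ad x y = 0) -> x = 0.
Proof.
move=> x0; have [[u [v uv0]] ideals] := gS.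
have [U0|Uf] : lker (@ad F g) = 0%VS \/ lker (@ad F g) = fullv.
  apply: ideals => y z; rewrite !memv_ker => /eqP z0; apply/eqP.
  by rewrite adC z0 zero_lfunE oppr0 linear0.
  apply/eqP; rewrite -memv0 -U0 memv_ker; apply/eqP/lfunP => y.
  by rewrite x0 zero_lfunE.
have : u \in lker (@ad F g) by rewrite Uf memvf.
by rewrite memv_ker => /eqP u0; rewrite u0 zero_lfunE eqxx in uv0.
Qed.

Lemma weights_separate h : (forall i, wt i h = 0) -> h = 0.
Proof.
move=> h0; apply: val_inj; apply: centerless => y.
rewrite [y]bE linear_sum big1 // => i _.
by rewrite linearZ /= bw h0 scale0r scaler0.
Qed.

(** If all brackets of opposite root vectors vanished, the span of the root
    vectors would contain [g, g] and so be an ideal; it would be all of g,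
    leaving nothing for t, which is however its own centralizer. *)
Lemma nonzero_root_bracket :
  exists i j, [/\ wt i != 0, wt j = - wt i & ad b`_i b`_j != 0].
Proof.
apply: contrapT => H.
have [[u [v uv0]] ideals] := gS.
pose U := (\sum_(k | wt k != 0%R) <[b`_k]>)%VS.
have bU k : wt k != 0 -> b`_k \in U.
  by move=> k0; apply: (subvP (sumv_sup k k0 (subvv _))); apply: memv_line.
have adU x y : ad x y \in U.
  rewrite [x]bE linear_sum sum_lfunE; apply: memv_suml => i _.
  rewrite linearZ scale_lfunE; apply: memvZ.
  rewrite [y]bE linear_sum; apply: memv_suml => j _.
  rewrite linearZ; apply: memvZ => /=.
  have ijw := weight_ad (bw i) (bw j).
  have [ij0|ij0] := eqVneq (wt i + wt j) 0; last first.
    rewrite [ad _ _]bE; apply: memv_suml => k _.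
    have [->|ck] := eqVneq (coord b k (ad b`_i b`_j)) 0.
      by rewrite scale0r mem0v.
    by apply/memvZ/bU; rewrite (coord_weight bB bw ijw ck).
  suff -> : ad b`_i b`_j = 0 by apply: mem0v.
  have [i0|i0] := eqVneq (wt i) 0.
    have j0 : wt j = 0 by rewrite i0 add0r in ij0.
    have iw := bw i; rewrite i0 in iw; have [h <-] := weight0_cartan iw.
    by rewrite bw j0 zero_lfunE scale0r.
  apply/eqP/negPn/negP => ad0; apply: H; exists i, j; split=> //.
  by apply/eqP; rewrite -addr_eq0 addrC ij0.
have [U0|Uf] := ideals U (fun x y _ => adU x y).
  by case/eqP: uv0; apply/eqP; rewrite -memv0 -U0 adU.
have wt0 k : wt k != 0.
  apply/eqP => k0.
  have : b`_k \in U by rewrite Uf memvf.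
  case/memv_sumP => w wU bk.
  have := coord_free k k (basis_free bB); rewrite eqxx bk linear_sum big1 /=.
    by move/eqP; rewrite eq_sym oner_eq0.
  move=> i i0; have /vlineP[c ->] := wU i i0.
  rewrite linearZ /= coord_free ?(basis_free bB) //.
  by case: eqP => [ik|]; rewrite ?mulr0 //; rewrite ik k0 eqxx in i0.
(* A nonzero element of t would involve a basis vector of weight zero. *)
have t0 h : h = 0.
  apply: val_inj; rewrite /= [vsval h]bE big1 // => k _.
  have [->|ck] := eqVneq (coord b k (vsval h)) 0; first by rewrite scale0r.
  have hw : weight_vector (0 : dual) (vsval h).
    move=> h'; rewrite zero_lfunE scale0r.
    by case: tC => tab _ _; apply: tab; apply: subvsP.
  by have := wt0 k; rewrite (coord_weight bB bw hw ck) eqxx.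
have ut : weight_vector (0 : dual) u.
  by move=> h; rewrite (t0 h) !linear0 !zero_lfunE scale0r.
have [h hu] := weight0_cartan ut.
by case/eqP: uv0; rewrite -hu (t0 h) !linear0 zero_lfunE.
Qed.

(** The radical is an ideal, so it suffices to find one h with a nonzero value
    at (h, h).  For h a nonzero bracket of opposite root vectors of weight
    alpha, all weights take values in the rational multiples of alpha(h), so
    that value is alpha(h)^2 times a sum of rational squares. *)
Lemma killing_nondegenerate x : (forall y, killing x y = 0) -> x = 0.
Proof.
have [_ ideals] := gS.
pose kf x : 'rV[F]_N := \row_j killing x b`_j.
have kf_lin : linear kf by move=> c y z; apply/rowP => j; rewrite !mxE killingPl.
have [k kE] := lfun_of_linear kf_lin.
have kP y : (y \in lker k) <-> forall z, killing y z = 0.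
  rewrite memv_ker kE; split=> [/eqP y0 z|y0]; last first.
    by apply/eqP/rowP => j; rewrite !mxE y0.
  rewrite [z]bE; elim/big_rec: _ => [|i w _ IH].
    by have := killing_Zr 0 y 0; rewrite scaler0 mul0r.
  rewrite killingDr IH addr0 killing_Zr.
  by move/rowP/(_ i): y0; rewrite !mxE => ->; rewrite mulr0.
move=> x0; have [k0|kf0] : lker k = 0%VS \/ lker k = fullv.
- apply: ideals => y z /kP z0; apply/kP => w.
  by rewrite adC -scaleN1r killingZl killing_invariant z0 mulr0.
- by apply/eqP; rewrite -memv0 -k0; apply/kP.
have [i [j [i0 ij ad0]]] := nonzero_root_bracket.
have jw := bw j; rewrite ij in jw.
have hw : weight_vector (0 : dual) (ad b`_i b`_j).
  by rewrite -(subrr (wt i)); apply: weight_ad.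
have [h hE] := weight0_cartan hw.
pose r l := sval (cid (weight_ratio bB bw l i0 hE (bw i) jw)).
have rE l : wt l h = ratr (r l) * wt i h by rewrite /r; case: cid.
have wih : wt i h != 0.
  apply: contra ad0 => /eqP wih; rewrite -hE (weights_separate (h := h)) ?linear0 //.
  by move=> l; rewrite rE wih mulr0.
have : vsval h \in lker k by rewrite kf0 memvf.
move/kP/(_ (vsval h)); rewrite (killing_cartan bB bw).
rewrite (eq_bigr (fun l => ratr (r l ^+ 2) * wt i h ^+ 2)); last first.
  by move=> l _; rewrite rE rmorphXn /=; ring.
rewrite -mulr_suml => /eqP; rewrite mulf_eq0 expf_eq0 (negPf wih) orbF.
rewrite psumr_eq0 => [/allP/(_ i (mem_index_enum i))|l _]; last first.
  by rewrite ler0q sqr_ge0.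
rewrite /= fmorph_eq0 expf_eq0 /= => /eqP ri.
by have := rE i; rewrite ri rmorph0 mul0r => /eqP; rewrite (negPf wih).
Qed.

(** Invariance gives (alpha + beta)(h) killing x y = 0 for all h. *)
Lemma killing_orthogonal alpha beta x y :
  weight_vector alpha x -> weight_vector beta y -> alpha + beta != 0 ->
  killing x y = 0.
Proof.
move=> xa yb ab0; apply/eqP/negPn/negP => k0; case/eqP: ab0; apply/lfunP => h.
rewrite zero_lfunE add_lfunE; apply/eqP.
have : killing (ad x (vsval h)) y = killing x (ad (vsval h) y).
  exact: killing_invariant.
rewrite adC -scaleN1r killingZl xa killingZl yb killing_Zr mulN1r.
by move/eqP; rewrite eq_sym -addr_eq0 addrC -mulrDl mulf_eq0 (negPf k0) orbF.
Qed.

(** The root vectors are orthogonal to t, and the basis vectors of weight zero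
    lie in t, so the radical of the restriction lies in the radical. *)
Lemma cartan_nondegenerate h :
  (forall h', killing (vsval h) (vsval h') = 0) -> h = 0.
Proof.
move=> h0; apply: val_inj; apply: killing_nondegenerate => y.
rewrite [y]bE; elim/big_rec: _ => [|i w _ IH].
  by have := killing_Zr 0 (vsval h) 0; rewrite scaler0 mul0r.
rewrite killingDr IH addr0 killing_Zr; apply/eqP; rewrite mulf_eq0; apply/orP; right.
have hw : weight_vector (0 : dual) (vsval h).
  move=> h'; rewrite zero_lfunE scale0r.
  by case: tC => tab _ _; apply: tab; apply: subvsP.
have iw := bw i; have [i0|i0] := eqVneq (wt i) 0.
  by rewrite i0 in iw; have [h' <-] := weight0_cartan iw; rewrite h0.
by apply/eqP; apply: (killing_orthogonal hw iw); rewrite add0r.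
Qed.

End SimpleStructure.

(** * Roots, coroots and root strings *)

Section RootFacts.
Variables (F : numFieldType) (g : lieAlgebra F) (t : {vspace g}).
Local Notation T := (subvs_of t).
Local Notation dual := 'Hom(T, F^o).
Hypothesis gS : lie_simple g.
Hypothesis tC : cartan_subalgebra t.
Implicit Types (x y e f v u : g) (h a : T) (alpha beta : dual).

Definition is_root alpha :=
  alpha != 0 /\ exists2 x, x != 0 & weight_vector alpha x.

(** The element of t corresponding to alpha under the Killing form, that is,
    the coroot up to the factor 2 / alpha a. *)
Definition represents a alpha :=
  forall h, killing (vsval a) (vsval h) = alpha h.

Lemma roots_finite : exists s : seq dual, forall alpha, is_root alpha -> alpha \in s.
Proof.
have [b [wt [bB bw]]] := weight_basis tC.
exists (codom wt) => alpha [_ [x x0 xa]].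
by have [i <-] := weight_in_basis bB bw xa x0; apply: codom_f.
Qed.

Lemma represents_unique alpha a a' :
  represents a alpha -> represents a' alpha -> a = a'.
Proof.
have [b [wt [bB bw]]] := weight_basis tC.
move=> aR a'R; apply/eqP; rewrite -subr_eq0; apply/eqP.
apply: (cartan_nondegenerate bB bw gS tC) => h.
rewrite linearB /= addrC -scaleN1r killingPl aR a'R.
by rewrite mulN1r addNr.
Qed.

(** By invariance, the bracket and the multiple of a pair in the same way with
    every element of t. *)
Lemma bracket_represents alpha e f a : represents a alpha ->
  weight_vector alpha e -> weight_vector (- alpha) f ->
  ad e f = killing e f *: vsval a.
Proof.
have [b [wt [bB bw]]] := weight_basis tC.
move=> aR ea fa.
have ef0 : weight_vector (0 : dual) (ad e f).
  by rewrite -(subrr alpha); apply: weight_ad.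
have [h hE] := weight0_cartan tC ef0; rewrite -hE.
suff -> : h = killing e f *: a by rewrite linearZ.
apply/eqP; rewrite -subr_eq0; apply/eqP.
apply: (cartan_nondegenerate bB bw gS tC) => h'.
rewrite linearB /= addrC -scaleN1r killingPl killingZl aR hE.
rewrite killing_invariant adC fa opp_lfunE scaleNr opprK killing_Zr.
by rewrite mulN1r mulrC addNr.
Qed.

Lemma root_opposite_vector alpha e : alpha != 0 -> weight_vector alpha e -> e != 0 ->
  exists f, weight_vector (- alpha) f /\ killing e f = 1.
Proof.
have [b [wt [bB bw]]] := weight_basis tC.
move=> a0 ea e0.
have [j cj] : exists j : 'I_(\dim {:g}), killing e b`_j != 0.
  apply: contrapT => /forallNP H; case/eqP: e0.
  apply: (killing_nondegenerate bB bw gS tC) => y.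
  rewrite [y](coord_basis bB) ?memvf //; elim/big_rec: _ => [|i w _ IH].
    by have := killing_Zr 0 e 0; rewrite scaler0 mul0r.
  rewrite killingDr IH addr0 killing_Zr; have /negP := H i.
  by rewrite negbK => /eqP ->; rewrite mulr0.
have ja : wt j = - alpha.
  apply/eqP; rewrite -addr_eq0 addrC; apply: contraR cj => ja.
  by apply/eqP; apply: killing_orthogonal ea (bw j) ja.
exists ((killing e b`_j)^-1 *: b`_j); split.
  by apply: weightZ; rewrite -ja.
by rewrite killing_Zr mulVf.
Qed.

Lemma rootN alpha : is_root alpha -> is_root (- alpha).
Proof.
move=> [a0 [e e0 ea]]; have [f [fa ef]] := root_opposite_vector a0 ea e0.
split; first by rewrite oppr_eq0.
exists f => //; apply/eqP => f0; have := killing_Zr 0 e 0.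
by rewrite scaler0 mul0r -f0 ef => /eqP; rewrite oner_eq0.
Qed.

(** Choose f of weight -alpha with killing e f = 1; then [e, f] represents
    alpha. *)
Lemma root_triple alpha : is_root alpha -> exists e f a,
  [/\ e != 0, weight_vector alpha e, weight_vector (- alpha) f,
      represents a alpha & vsval a = ad e f].
Proof.
move=> [a0 [e e0 ea]]; have [f [fa ef1]] := root_opposite_vector a0 ea e0.
have ef0 : weight_vector (0 : dual) (ad e f).
  by rewrite -(subrr alpha); apply: weight_ad.
have [h hE] := weight0_cartan tC ef0.
exists e, f, h; split=> // h'; rewrite hE killing_invariant adC fa.
by rewrite opp_lfunE scaleNr opprK killing_Zr ef1 mulr1.
Qed.

Lemma root_represented alpha : is_root alpha -> exists a, represents a alpha.
Proof. by move=> /root_triple[_ [_ [a [_ _ _ aR _]]]]; exists a. Qed.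

(** Every weight takes at a the value r alpha(a) with r rational, so that
    alpha(a) = killing a a = alpha(a)^2 S, with S a sum of rational squares,
    and alpha(a) S = 1 as alpha(a) is nonzero. *)
Lemma represents_gt0 alpha a : is_root alpha -> represents a alpha -> 0 < alpha a.
Proof.
have [b [wt [bB bw]]] := weight_basis tC.
move=> ra aR; have [a0 _] := ra.
have [e [f [a' [e0 ea fa a'R a'E]]]] := root_triple ra.
have aE : vsval a = ad e f by rewrite (represents_unique aR a'R).
pose r l := sval (cid (weight_ratio bB bw l a0 aE ea fa)).
have rE l : wt l a = ratr (r l) * alpha a by rewrite /r; case: cid.
have aa : alpha a != 0.
  apply/eqP => aa; case/eqP: (a0); apply/lfunP => h.
  rewrite -aR (weights_separate bB bw gS (h := a)) ?linear0; last first.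
    by move=> i; rewrite rE aa mulr0.
  by rewrite -(scale0r (0 : g)) killingZl mul0r zero_lfunE.
have sE : alpha a = alpha a ^+ 2 * \sum_l ratr (r l ^+ 2).
  rewrite -{1}aR (killing_cartan bB bw) mulr_sumr; apply: eq_bigr => l _.
  by rewrite rE rmorphXn /=; ring.
have s1 : alpha a * \sum_l ratr (r l ^+ 2) = 1.
  by apply: (mulfI aa); rewrite mulrA -expr2 -sE mulr1.
have s0 : 0 <= \sum_l ratr (r l ^+ 2) :> F.
  by apply: sumr_ge0 => l _; rewrite ler0q sqr_ge0.
have sn0 : \sum_l ratr (r l ^+ 2) != 0 :> F.
  by apply/eqP => s00; move/eqP: s1; rewrite s00 mulr0 eq_sym oner_eq0.
by rewrite -(pmulr_lgt0 _ (x := \sum_l ratr (r l ^+ 2))) ?s1 ?ltr01 // lt0r sn0.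
Qed.

(** Raise a vector of weight beta to a primitive vector of weight
    beta + q alpha, with associated integer k; then c = k - 2 q, and the nonzero
    vectors f^(q+j) v have the weights beta - j alpha as long as q + j <= k. *)
Lemma root_string alpha beta a : is_root alpha -> is_root beta ->
  represents a alpha -> exists c : int,
    beta a = c%:~R / 2 * alpha a /\
    forall j : nat, j%:Z <= c ->
      beta - alpha *+ j = 0 \/ is_root (beta - alpha *+ j).
Proof.
have [b [wt [bB bw]]] := weight_basis tC.
move=> ra [_ [x x0 xb]] aR; have [a0 _] := ra.
have [e [f [a' [e0 ea fa a'R a'E]]]] := root_triple ra.
have aE : vsval a = ad e f by rewrite (represents_unique aR a'R).
have [q [q0 q1]] := iter_weight_top bB bw a0 ea xb x0.
have [k [kE kf]] := primitive_chain bB bw a0 aE ea fa (weight_iter q ea xb) q0 q1.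
exists (k%:Z - (2 * q)%:Z); split.
  rewrite rmorphB /= -!pmulrn natrM mulrBl mulrBl -kE add_lfunE lfunMnE.
  by rewrite -[alpha a *+ q]mulr_natl; field.
move=> j jc; have jk : (q + j <= k)%N by lia.
have := weight_iter (q + j) fa (weight_iter q ea xb).
rewrite mulNrn mulrnDr opprD addrA addrK => wj.
have [->|j0] := eqVneq (beta - alpha *+ j) 0; first by left.
by right; split=> //; eexists; [apply: kf jk|].
Qed.

(** Take v primitive of weight m alpha and suppose m >= 2.  Then f^m v lies in
    the line of [e, f], so that e f^m v is a multiple of e, and so is f^(m-1) v
    by [eigen_chain].  Hence e kills f^(m-1) v, contradicting [eigen_chain] and
    the fact that f^(m-2) v is nonzero. *)
Lemma root_reduced alpha n : is_root alpha -> is_root (alpha *+ n) -> n = 1%N.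
Proof.
have [b [wt [bB bw]]] := weight_basis tC.
move=> ra [n0 [x x0 xn]]; have [a0 _] := ra.
have {n0} n0 : (0 < n)%N by case: n n0 {xn} => //; rewrite mulr0n eqxx.
have [e [f [a [e0 ea fa aR aE]]]] := root_triple ra.
have aa0 := lt0r_neq0 (represents_gt0 ra aR).
have [q [v0 ev0]] := iter_weight_top bB bw a0 ea xn x0.
have vm := weight_iter q ea xn; rewrite -mulrnDr in vm.
set v := iter q (ad e) x in v0 vm; rewrite iterS -/v in ev0.
case E : (n + q)%N vm => [|[|m]] vm; [lia|lia|exfalso].
have [k [kE kf]] := primitive_chain bB bw a0 aE ea fa vm v0 ev0.
have chain := eigen_chain _ aE ea fa vm ev0.
(* v has weight m + 2 times alpha, so its chain has 2 (m + 2) + 1 terms. *)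
have kE' : k = (2 * m.+2)%N.
  apply/eqP; rewrite -(eqr_nat F); apply/eqP; apply: (mulIf aa0).
  have := kE; rewrite lfunMnE -[alpha a *+ _]mulr_natl => kE2.
  by rewrite natrM -mulrA kE2; field.
(* w plays the role of f^(m-1) v, since the multiple here is m + 2. *)
pose w := iter m.+1 (ad f) v.
have ww : weight_vector alpha w.
  have := weight_iter m.+1 fa vm.
  by rewrite mulNrn [alpha *+ m.+2]mulrS addrK.
have efw : ad e (ad f w) = (killing w f * alpha a) *: e.
  have -> : ad f w = - (killing w f *: vsval a).
    by rewrite adC (bracket_represents aR ww fa).
  by rewrite linearN linearZ /= adC ea scalerN opprK scalerA.
have := chain m.+1; rewrite -[iter m.+2 _ _]/(ad f w) efw -/w => wE.
have c0 i : (i < m.+2)%N -> i.+1%:R * ((alpha *+ m.+2) a - i%:R / 2 * alpha a) != 0.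
  move=> im; rewrite mulf_neq0 ?pnatr_eq0 // lfunMnE -[alpha a *+ _]mulr_natl.
  rewrite -mulrBl mulf_neq0 // subr_eq0.
  rewrite -(inj_eq (mulIf (_ : 2 != 0 :> F))) ?pnatr_eq0 // divfK ?pnatr_eq0 //.
  by rewrite -natrM eqr_nat; lia.
have wc : exists c, w = c *: e.
  exists ((m.+2%:R * ((alpha *+ m.+2) a - m.+1%:R / 2 * alpha a))^-1 *
            (killing w f * alpha a)).
  by rewrite -scalerA wE scalerA mulVf ?scale1r // c0.
have [c cE] := wc.
have := chain m; rewrite -/w cE linearZ /= lie_alternating scaler0 => /esym/eqP.
rewrite scaler_eq0 (negPf (c0 _ (ltnW (ltnSn _)))) /= => w0.
have mk : (m <= k)%N by rewrite kE'; lia.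
by move: (kf m mk); rewrite w0.
Qed.

End RootFacts.

(** * Reflections and the Weyl group *)

Local Open Scope classical_set_scope.
Local Notation roots := Defs.roots.

Section Reflections.
Variables (R : realType) (g : lieAlgebra R[i]) (t : {vspace g}).
Hypothesis gS : lie_simple g.
Hypothesis tC : cartan_subalgebra t.
Local Notation T := (subvs_of t).
Local Notation D := (tdual t).
Local Notation form x y := (killing (vsval x) (vsval y)).
Implicit Types (x y a z : T) (alpha beta gamma : D) (u w s : 'End(T)).

(** A choice of the vector representing alpha; 0 if there is none. *)
Definition rep alpha : T := xget 0 [set a | represents a alpha].

Lemma repP alpha : roots alpha -> represents (rep alpha) alpha.
Proof.
move=> /(root_represented gS tC)[a aR].
exact: (@xgetI _ 0 [set a | represents a alpha] a aR).
Qed.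

Lemma rep_gt0 alpha : roots alpha -> 0 < alpha (rep alpha).
Proof. by move=> ra; apply: (represents_gt0 gS tC ra); apply: repP. Qed.

Lemma root_neq0 alpha : roots alpha -> alpha <> 0.
Proof. by case=> /eqP. Qed.

Lemma rep_unique a alpha : roots alpha -> represents a alpha -> a = rep alpha.
Proof. by move=> ra aR; apply: (represents_unique gS tC aR); apply: repP. Qed.

Lemma rep_sym alpha beta : roots alpha -> roots beta ->
  alpha (rep beta) = beta (rep alpha).
Proof. by move=> ra rb; rewrite -(repP ra) -(repP rb) killingC. Qed.

Lemma formZl c x y : form (c *: x) y = c * form x y.
Proof. by rewrite linearZ /= killingZl. Qed.

Lemma formBl x y z : form (x - y) z = form x z - form y z.
Proof. by rewrite linearB /= addrC -scaleN1r killingPl mulN1r addrC. Qed.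

Lemma formBr x y z : form x (y - z) = form x y - form x z.
Proof. by rewrite killingC formBl !(killingC (vsval x)). Qed.

Lemma formZr c x y : form x (c *: y) = c * form x y.
Proof. by rewrite killingC formZl killingC. Qed.

Lemma repN alpha : roots alpha -> rep (- alpha) = - rep alpha.
Proof.
move=> ra; apply/esym/rep_unique; first exact: (rootN gS tC).
by move=> h; rewrite -scaleN1r formZl (repP ra) opp_lfunE mulN1r.
Qed.

Lemma refl_linear alpha :
  linear (fun x => x - (2 * alpha x / alpha (rep alpha)) *: rep alpha).
Proof.
move=> c x y /=; rewrite scalerBr scalerA addrACA -opprD -scalerDl.
congr (_ - _ *: _); rewrite linearP /= -[_ *: alpha x]/(_ * _).
by rewrite mulrDr mulrDl !mulrA [c * 2]mulrC.
Qed.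

Definition refl alpha : 'End(T) := sval (cid (lfun_of_linear (refl_linear alpha))).

Lemma reflE alpha x :
  refl alpha x = x - (2 * alpha x / alpha (rep alpha)) *: rep alpha.
Proof. by rewrite /refl; case: cid. Qed.

(** The vector representing alpha is unique, by nondegeneracy. *)
Lemma is_reflectionP alpha s : roots alpha -> is_reflection alpha s -> s = refl alpha.
Proof.
move=> ra [a aR sE]; apply/lfunP => x.
by rewrite sE reflE -(rep_unique ra aR).
Qed.

Lemma refl_is_reflection alpha : roots alpha -> is_reflection alpha (refl alpha).
Proof. by move=> ra; exists (rep alpha); [apply: repP | apply: reflE]. Qed.

Lemma reflN alpha : roots alpha -> refl (- alpha) = refl alpha.
Proof.
move=> ra; apply/lfunP => x; rewrite !reflE repN // !opp_lfunE (linearN alpha) opprK.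
by rewrite mulrN mulNr scaleNr scalerN !opprK.
Qed.

Lemma reflK alpha : roots alpha -> involutive (refl alpha).
Proof.
move=> ra x; have a0 := lt0r_neq0 (rep_gt0 ra).
rewrite reflE [alpha (refl _ _)](_ : _ = - alpha x); last first.
  rewrite reflE linearB linearZ /=.
  by rewrite -[_ *: _]/(_ * _) divfK //; ring.
by rewrite reflE mulrN mulNr scaleNr opprK subrK.
Qed.

Lemma refl_form alpha x y : roots alpha ->
  form (refl alpha x) (refl alpha y) = form x y.
Proof.
move=> ra; have a0 := lt0r_neq0 (rep_gt0 ra).
have fx z : form z (rep alpha) = alpha z by rewrite killingC (repP ra).
rewrite !reflE formBl !formBr !formZl !formZr !fx (repP ra); by field.
Qed.

Lemma weyl_lker0 w : weyl_group w -> lker w == 0%VS.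
Proof.
elim=> [|alpha s {}w ra sE _ IH]; apply/lker0P.
  by move=> x y; rewrite !id_lfunE.
move=> x y; rewrite !comp_lfunE (is_reflectionP ra sE).
by move/(can_inj (reflK ra)); apply: (lker0P IH).
Qed.

Lemma weylK w x : weyl_group w -> (w^-1)%VF (w x) = x.
Proof. by move=> wW; apply: lker0_lfunK; apply: weyl_lker0. Qed.

Lemma weylVK w x : weyl_group w -> w ((w^-1)%VF x) = x.
Proof. by move=> wW; apply: lker0_lfunVK; apply: weyl_lker0. Qed.

Lemma weyl_refl alpha : roots alpha -> weyl_group (refl alpha).
Proof.
move=> ra; rewrite -[refl _]comp_lfun1r.
by apply: (weyl_mul ra); [apply: refl_is_reflection | apply: weyl_one].
Qed.

Lemma weyl_comp u w : weyl_group u -> weyl_group w -> weyl_group (u \o w)%VF.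
Proof.
move=> uW wW; elim: uW => [|alpha s {}u ra sE _ IH].
  by rewrite comp_lfun1l.
by rewrite -comp_lfunA; apply: (weyl_mul ra sE).
Qed.

(** The inverse of a linear map is only meaningful for injective maps; for
    elements of the Weyl group a right inverse identifies it. *)
Lemma inv_lfun_eq u w : weyl_group u -> (forall x, u (w x) = x) -> (u^-1)%VF = w.
Proof.
by move=> uW uwK; apply/lfunP => x; rewrite -{1}(uwK x) (weylK _ uW).
Qed.

Lemma weylV w : weyl_group w -> weyl_group (w^-1)%VF.
Proof.
elim=> [|alpha s {}w ra sE wW IH].
  rewrite (inv_lfun_eq (weyl_one t) (w := \1%VF)); first exact: weyl_one.
  by move=> x; rewrite !id_lfunE.
have -> := is_reflectionP ra sE.
have rW := weyl_refl ra.
rewrite (inv_lfun_eq (w := (w^-1 \o refl alpha)%VF)).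
- exact: weyl_comp.
- exact: weyl_comp.
by move=> x; rewrite !comp_lfunE weylVK // reflK.
Qed.

Lemma weylVV w : weyl_group w -> ((w^-1)^-1)%VF = w.
Proof.
by move=> wW; apply: inv_lfun_eq; [apply: weylV | move=> x; apply: weylK].
Qed.

Lemma weyl_form w x y : weyl_group w -> form (w x) (w y) = form x y.
Proof.
elim=> [|alpha s {}w ra sE _ IH]; first by rewrite !id_lfunE.
by rewrite !comp_lfunE (is_reflectionP ra sE) refl_form.
Qed.

Lemma dual_actE w alpha x : dual_act w alpha x = alpha ((w^-1)%VF x).
Proof. exact: comp_lfunE. Qed.

Lemma dual_act_eval w alpha x : weyl_group w -> dual_act w alpha (w x) = alpha x.
Proof. by move=> wW; rewrite dual_actE weylK. Qed.

Lemma dual_actV_eval w alpha x : weyl_group w ->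
  dual_act (w^-1)%VF alpha x = alpha (w x).
Proof. by move=> wW; rewrite dual_actE weylVV. Qed.

Lemma dual_actD w alpha beta :
  dual_act w (alpha + beta) = dual_act w alpha + dual_act w beta.
Proof. by apply/lfunP => x; rewrite add_lfunE !dual_actE add_lfunE. Qed.

Lemma dual_actN w alpha : dual_act w (- alpha) = - dual_act w alpha.
Proof. by apply/lfunP => x; rewrite opp_lfunE !dual_actE opp_lfunE. Qed.

Lemma dual_act1 alpha : dual_act \1%VF alpha = alpha.
Proof.
apply/lfunP => x; rewrite dual_actE (inv_lfun_eq (weyl_one t) (w := \1%VF)) ?id_lfunE //.
by move=> y; rewrite !id_lfunE.
Qed.

Lemma dual_act_comp u w alpha : weyl_group u -> weyl_group w ->
  dual_act (u \o w)%VF alpha = dual_act u (dual_act w alpha).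
Proof.
move=> uW wW; apply/lfunP => x; rewrite 3!dual_actE.
rewrite (inv_lfun_eq (w := (w^-1 \o u^-1)%VF)) ?comp_lfunE //.
  exact: weyl_comp.
by move=> y; rewrite !comp_lfunE !weylVK.
Qed.

Lemma dual_actK w alpha : weyl_group w ->
  dual_act (w^-1)%VF (dual_act w alpha) = alpha.
Proof. by move=> wW; apply/lfunP => x; rewrite dual_actV_eval // dual_act_eval. Qed.

Lemma dual_actVK w alpha : weyl_group w ->
  dual_act w (dual_act (w^-1)%VF alpha) = alpha.
Proof. by move=> wW; apply/lfunP => x; rewrite dual_actE dual_actV_eval // weylVK. Qed.

Lemma refl_inv alpha : roots alpha -> ((refl alpha)^-1)%VF = refl alpha.
Proof. by move=> ra; apply: inv_lfun_eq; [apply: weyl_refl | apply: reflK]. Qed.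

Lemma refl_eval alpha beta x : roots alpha ->
  dual_act (refl alpha) beta x = beta (refl alpha x).
Proof. by move=> ra; rewrite dual_actE refl_inv. Qed.

Lemma dual_reflK alpha : roots alpha -> involutive (dual_act (refl alpha)).
Proof. by move=> ra beta; apply/lfunP => x; rewrite !refl_eval // reflK. Qed.

Lemma dual_refl_self alpha : roots alpha -> dual_act (refl alpha) alpha = - alpha.
Proof.
move=> ra; have a0 := lt0r_neq0 (rep_gt0 ra).
apply/lfunP => x; rewrite refl_eval // reflE linearB linearZ /= opp_lfunE.
by rewrite -[_ *: _]/(_ * _) divfK //; ring.
Qed.

(** Both directions of the root string: the string downwards from beta when the
    Cartan integer c is nonnegative, and upwards, by passing to -alpha, when it
    is negative. *)
Lemma root_pairing alpha beta : roots alpha -> roots beta ->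
  exists c : int, [/\ beta (rep alpha) = c%:~R / 2 * alpha (rep alpha),
    dual_act (refl alpha) beta = beta - alpha *~ c,
    forall j : nat, j%:Z <= c ->
      beta - alpha *+ j = 0 \/ roots (beta - alpha *+ j) &
    forall j : nat, j%:Z <= - c ->
      beta + alpha *+ j = 0 \/ roots (beta + alpha *+ j)].
Proof.
move=> ra rb; have a0 := lt0r_neq0 (rep_gt0 ra).
have [c [cE0 cS]] := root_string gS tC ra rb (repP ra).
have cE : beta (rep alpha) = c%:~R / 2 * alpha (rep alpha) := cE0.
have rNa := rootN gS tC ra.
have [d [dE0 dS]] := root_string gS tC rNa rb (repP rNa).
have dE : beta (rep (- alpha)) = d%:~R / 2 * (- alpha) (rep (- alpha)) := dE0.
have dc : d = - c.
  move: dE; rewrite repN // opp_lfunE (linearN beta) (linearN alpha) /=.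
  rewrite opprK cE => /esym/eqP; rewrite -mulNr (inj_eq (mulIf a0)) -mulNr.
  rewrite (inj_eq (mulIf _)) ?invr_eq0 ?pnatr_eq0 // -rmorphN /=.
  by rewrite eqr_int => /eqP.
exists c; split=> //.
  apply/lfunP => x; rewrite refl_eval // reflE linearB linearZ /= cE.
  rewrite add_lfunE opp_lfunE; congr (_ - _).
  have -> : (alpha *~ c) x = c%:~R * alpha x.
    case: (c) => n; rewrite ?NegzE ?mulrNz ?opp_lfunE -!pmulrn lfunMnE.
      by rewrite -[LHS]mulr_natl.
    by rewrite mulNr -[in LHS]mulr_natl.
  by rewrite -[_ *: _]/(_ * _); field.
move=> j jc; have := dS j; rewrite dc => /(_ jc).
by rewrite mulNrn opprK.
Qed.

(** The reflected root is the far end of the root string. *)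
Lemma refl_root alpha beta : roots alpha -> roots beta ->
  roots (dual_act (refl alpha) beta).
Proof.
move=> ra rb; have [c [cE bR cS cS']] := root_pairing ra rb.
have n0 : beta - alpha *~ c <> 0.
  move=> b0; apply: (root_neq0 rb).
  rewrite -[LHS](dual_reflK ra) bR b0; apply/lfunP => x.
  by rewrite dual_actE !zero_lfunE.
rewrite bR; case: c {cE bR} cS cS' n0 => n cS cS' n0.
  by case: (cS n (lexx _)) => // /n0.
have := cS' n.+1; rewrite NegzE opprK => /(_ (lexx _)).
by rewrite NegzE mulrNz opprK -pmulrn in n0 *; case.
Qed.

End Reflections.

(** * Positive systems, simple reflections and length *)

(* Keeps conversion from unfolding these maps down to matrices. *)
Local Opaque dual_act refl rep comp_lfun inv_lfun.

Lemma count_lt (T : eqType) (p q : pred T) (s : seq T) y :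
  (forall x, p x -> q x) -> y \in s -> q y -> ~~ p y ->
  (count p s < count q s)%N.
Proof.
move=> pq ys qy py.
have sp : count p [seq x <- s | q x] = count p s.
  rewrite count_filter; apply: eq_count => x /=.
  by apply/andb_idr/pq.
have hy : (0 < count (predC p) [seq x <- s | q x])%N.
  by rewrite -has_count; apply/hasP; exists y => //; rewrite mem_filter qy ys.
by have := count_predC p [seq x <- s | q x]; rewrite sp size_filter => <-; lia.
Qed.

(** Well-foundedness of a strict order on a finite set, by induction on the
    number of elements below. *)
Lemma finite_order_ind (T : eqType) (A : T -> Prop) (lt : T -> T -> Prop)
    (s : seq T) (Q : T -> Prop) :
  (forall x, A x -> x \in s) -> (forall x, A x -> ~ lt x x) ->
  (forall x y z, lt x y -> lt y z -> lt x z) ->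
  (forall x, A x -> (forall y, A y -> lt y x -> Q y) -> Q x) ->
  forall x, A x -> Q x.
Proof.
move=> As irr tr step; pose m x := count (fun y => `[< A y /\ lt y x >]) s.
have H n : forall x, A x -> (m x < n)%N -> Q x.
  elim: n => // n IH x Ax mx; apply: step => // y Ay yx; apply: IH => //.
  rewrite ltnS in mx; apply: leq_trans mx; apply: (count_lt (y := y)).
  - by move=> w /asboolP[Aw wy]; apply/asboolP; split=> //; apply: tr wy yx.
  - exact: As.
  - exact/asboolP.
  - by apply/negP => /asboolP[_]; apply: irr.
by move=> x Ax; apply: (H (m x).+1).
Qed.

Section Positive.
Variables (R : realType) (g : lieAlgebra R[i]) (t : {vspace g}).
Hypothesis gS : lie_simple g.
Hypothesis tC : cartan_subalgebra t.
Variable P : set (tdual t).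
Hypothesis PS : positive_system P.
Local Notation T := (subvs_of t).
Local Notation D := (tdual t).
Implicit Types (x y a z : T) (alpha beta gamma delta : D) (u w s : 'End(T)).
Implicit Types (l : seq D).

Let Proot alpha : P alpha -> roots alpha.
Proof. by case: PS => H _ _; apply: H. Qed.

Let PnegN alpha : roots alpha -> ~ P alpha -> P (- alpha).
Proof.
by case: PS => _ H _ ra nP; apply: contrapT => nP'; apply/nP/H.
Qed.

Let Popp alpha : P alpha -> ~ P (- alpha).
Proof. by case: PS => _ H _ Pa; apply: (H _ (Proot Pa)).1. Qed.

Let PD alpha beta : P alpha -> P beta -> roots (alpha + beta) -> P (alpha + beta).
Proof. by case: PS => _ _; apply. Qed.

Lemma pairing_lt0 (c : int) alpha : roots alpha ->
  (c%:~R / 2 * alpha (rep alpha) < 0 :> R[i]) = (c < 0).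
Proof.
move=> ra; rewrite pmulr_llt0 ?(rep_gt0 gS tC ra) //.
by rewrite pmulr_llt0 ?invr_gt0 ?ltr0n // ltrz0.
Qed.

Lemma pairing_gt0 (c : int) alpha : roots alpha ->
  (0 < c%:~R / 2 * alpha (rep alpha) :> R[i]) = (0 < c).
Proof.
move=> ra; rewrite pmulr_lgt0 ?(rep_gt0 gS tC ra) //.
by rewrite pmulr_lgt0 ?invr_gt0 ?ltr0n // ltr0z.
Qed.

Lemma pairing_real alpha beta : roots alpha -> roots beta ->
  beta (rep alpha) \is Num.real.
Proof.
move=> ra rb; have [c [-> _ _ _]] := root_pairing gS tC ra rb.
by rewrite !rpredM ?rpredV ?realn ?realz // gtr0_real // rep_gt0.
Qed.

(** The Cartan integer is negative, so the root string contains the next step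
    upwards. *)
Lemma obtuse_add alpha beta : roots alpha -> roots beta ->
  beta (rep alpha) < 0 -> beta + alpha = 0 \/ roots (beta + alpha).
Proof.
move=> ra rb; have [c [-> _ _ cS]] := root_pairing gS tC ra rb.
by rewrite pairing_lt0 // => c0; apply: (cS 1%N); lia.
Qed.

(** In a vanishing sum, the first root gamma pairs negatively with the sum of
    the others, hence with some summand delta among them.  Then gamma + delta is a
    root and replaces both, giving a shorter vanishing sum. *)
Lemma positive_sum_neq0 l : l != [::] -> (forall gamma, gamma \in l -> P gamma) ->
  \sum_(gamma <- l) gamma <> 0.
Proof.
have [n] := ubnP (size l); elim: n l => // n IH [|gamma l] //= sl _ lP s0.
have Pg : P gamma by apply: lP; rewrite mem_head.
have rg := Proot Pg.
have lP' delta : delta \in l -> P delta by move=> dl; apply: lP; rewrite in_cons dl orbT.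
rewrite big_cons in s0.
have sg : \sum_(delta <- l) delta (rep gamma) < 0.
  rewrite -sum_lfunE -(addKr gamma (\sum_(delta <- l) delta)) s0 addr0 opp_lfunE.
  by rewrite oppr_lt0 rep_gt0.
have [delta dl dneg] : exists2 delta, delta \in l & delta (rep gamma) < 0.
  apply: contrapT => H; move: sg; apply/negP.
  rewrite -real_leNgt ?real0 //; last first.
    rewrite big_seq; apply: sum_real => delta dl.
    by apply: pairing_real => //; apply/Proot/lP'.
  rewrite big_seq; apply: sumr_ge0 => delta dl.
  rewrite real_leNgt ?real0 //; last by apply: pairing_real => //; apply/Proot/lP'.
  by apply/negP => dneg; apply: H; exists delta.
have Pd := lP' _ dl; have rd := Proot Pd.
case: (obtuse_add rg rd dneg) => [dg0|rdg].
  apply: (Popp Pd); move/eqP: dg0; rewrite addrC addr_eq0 => /eqP <-; exact: Pg.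
have Pdg := PD Pd Pg rdg.
apply: (IH (delta + gamma :: rem delta l)) => //=.
- by rewrite size_rem //; case: (l) dl sl => //= _ l'; lia.
- move=> eta; rewrite in_cons => /orP[/eqP -> //|/mem_rem]; exact: lP'.
have lE : \sum_(eta <- l) eta = delta + \sum_(eta <- rem delta l) eta.
  by rewrite (perm_big _ (perm_to_rem dl)) big_cons.
by rewrite big_cons -[RHS]s0 lE [RHS]addrCA addrA.
Qed.

Definition below gamma beta := exists l,
  [/\ l != [::], forall delta, delta \in l -> P delta &
      beta = gamma + \sum_(delta <- l) delta].

Lemma below_trans alpha beta gamma :
  below alpha beta -> below beta gamma -> below alpha gamma.
Proof.
move=> [l [l0 lP ->]] [l' [l0' lP' ->]]; exists (l ++ l'); split.
- by case: (l) l0.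
- by move=> delta; rewrite mem_cat => /orP[/lP|/lP'].
by rewrite big_cat addrA.
Qed.

Lemma below_irrefl alpha : ~ below alpha alpha.
Proof.
move=> [l [l0 lP /esym/eqP]]; rewrite -subr_eq0 addrC addKr => /eqP.
exact: positive_sum_neq0.
Qed.

Lemma below_ind (Q : D -> Prop) :
  (forall beta, P beta -> (forall gamma, P gamma -> below gamma beta -> Q gamma) ->
     Q beta) ->
  forall beta, P beta -> Q beta.
Proof.
have [s sP] := roots_finite tC.
apply: (finite_order_ind (s := s)).
- by move=> beta /Proot; apply: sP.
- by move=> beta _; apply: below_irrefl.
- exact: below_trans.
Qed.

(** A positive root that is not simple is the sum of two lower ones. *)
Lemma positive_ind (Q : D -> Prop) :
  (forall alpha, simple_roots P alpha -> Q alpha) ->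
  (forall beta gamma, P beta -> P gamma -> P (beta + gamma) ->
     Q beta -> Q gamma -> Q (beta + gamma)) ->
  forall beta, P beta -> Q beta.
Proof.
move=> Qs QD; apply: below_ind => beta Pb IH.
have [[b1 [b2 [P1 P2 bE]]]|nb] :=
  pselect (exists b1 b2, [/\ P b1, P b2 & beta = b1 + b2]); last exact: Qs.
have lt1 d1 d2 : P d2 -> below d1 (d1 + d2).
  move=> Pd; exists [:: d2]; rewrite big_seq1; split=> //.
  by move=> delta; rewrite inE => /eqP ->.
rewrite bE in Pb IH *; apply: QD => //; apply: IH => //; first exact: lt1.
by rewrite addrC; apply: lt1.
Qed.

Lemma simple_root alpha : simple_roots P alpha -> roots alpha.
Proof. by case=> /Proot. Qed.

(** Walk along the root string from gamma to its reflection.  Downwards, a step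
    from a positive to a negative root would decompose alpha, and a step to zero
    would make gamma a multiple of alpha; upwards, positivity is preserved by
    closedness. *)
Lemma simple_refl_positive alpha gamma : simple_roots P alpha -> P gamma ->
  gamma <> alpha -> P (dual_act (refl alpha) gamma).
Proof.
move=> [Pa an] Pg ga; have ra := Proot Pa; have rg := Proot Pg.
have [c [_ -> cS cS']] := root_pairing gS tC ra rg.
case: c cS cS' => n cS cS'.
  suff H j : (j <= n)%N -> P (gamma - alpha *+ j) by apply: H.
  elim: j => [|j IH] jn; first by rewrite subr0.
  have {}IH := IH (ltnW jn).
  have [j0|rj] := cS j.+1 jn.
    move/eqP: j0; rewrite subr_eq0 => /eqP gE.
    have := root_reduced gS tC ra (n := j.+1); rewrite -gE => /(_ rg) j1.
    by case: ga; rewrite gE j1.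
  apply: contrapT => nPj; have := PnegN rj nPj; rewrite opprB => Pj.
  apply: an; exists (alpha *+ j.+1 - gamma), (gamma - alpha *+ j); split=> //.
  by rewrite addrA subrK mulrSr addrAC subrr add0r.
rewrite NegzE mulrNz opprK -pmulrn.
suff H j : (j <= n.+1)%N -> P (gamma + alpha *+ j) by apply: H.
elim: j => [|j IH] jn; first by rewrite addr0.
have {}IH := IH (ltnW jn).
rewrite mulrSr addrA; have := cS' j.+1 jn; rewrite mulrSr addrA => -[j0|rj].
  by move/eqP: j0; rewrite addr_eq0 => /eqP jE; rewrite jE in IH; case: (Popp Pa).
exact: PD.
Qed.

Lemma positive_le0 z : (forall alpha, simple_roots P alpha -> alpha z <= 0) ->
  forall beta, P beta -> beta z <= 0.
Proof.
move=> H; apply: positive_ind => // beta gamma _ _ _ bz gz.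
by rewrite add_lfunE; apply: ler_wnDr.
Qed.

(** Otherwise every simple root, hence every positive root, would pair
    nonpositively with beta, including beta itself. *)
Lemma acute_simple beta : P beta ->
  exists2 alpha, simple_roots P alpha & 0 < beta (rep alpha).
Proof.
move=> Pb; have rb := Proot Pb; apply: contrapT => H.
suff : beta (rep beta) <= 0.
  by apply/negP; rewrite -real_ltNge ?rep_gt0 // ?real0 // pairing_real.
apply: positive_le0 => // alpha sa; have ra := simple_root sa.
rewrite (rep_sym gS tC ra rb) real_leNgt ?real0 // ?pairing_real //.
by apply/negP => b0; apply: H; exists alpha.
Qed.

Lemma simple_word_cat m n u w :
  simple_word P m u -> simple_word P n w -> simple_word P (m + n) (u \o w)%VF.
Proof.
move=> uW wW; elim: uW => [|k alpha s {}u sa sE _ IH]; first by rewrite comp_lfun1l.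
by rewrite -comp_lfunA addSn; apply: (simple_word_cons sa sE).
Qed.

Lemma simple_word_refl alpha : simple_roots P alpha -> simple_word P 1 (refl alpha).
Proof.
move=> sa; rewrite -[refl _]comp_lfun1r.
apply: (simple_word_cons sa); last exact: simple_word_nil.
by apply: (refl_is_reflection gS tC); apply: simple_root.
Qed.

Lemma simple_word_weyl n w : simple_word P n w -> weyl_group w.
Proof.
elim=> [|k alpha s {}w sa sE _ IH]; first exact: weyl_one.
exact: (weyl_mul (simple_root sa) sE).
Qed.

Lemma weyl_root w alpha : weyl_group w -> roots alpha -> roots (dual_act w alpha).
Proof.
move=> wW; elim: wW alpha => [|beta s {}w rb sE wW IH] alpha ra.
  by rewrite (dual_act1 gS tC).
rewrite (is_reflectionP gS tC rb sE) (dual_act_comp gS tC) //; last exact: weyl_refl.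
by apply: (refl_root gS tC) => //; apply: IH.
Qed.

Lemma rep_act w alpha : weyl_group w -> roots alpha ->
  w (rep alpha) = rep (dual_act w alpha).
Proof.
move=> wW ra; apply: (rep_unique gS tC); first exact: weyl_root.
move=> h; rewrite -{1}(weylVK gS tC h wW) (weyl_form gS tC) //.
by rewrite (repP gS tC ra) dual_actE.
Qed.

(** The Weyl group preserves the Killing form, so it maps the vector
    representing alpha to the one representing its image. *)
Lemma refl_conj w alpha : weyl_group w -> roots alpha ->
  (w \o refl alpha)%VF = (refl (dual_act w alpha) \o w)%VF.
Proof.
move=> wW ra; apply/lfunP => x; rewrite !comp_lfunE !reflE linearB linearZ /=.
by rewrite -rep_act // !(dual_act_eval gS tC).
Qed.

(** If beta is not simple, a simple alpha at an acute angle moves it down to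
    beta' = s_alpha beta, and s_beta = s_alpha s_beta' s_alpha. *)
Lemma refl_simple_word beta : P beta -> exists n, simple_word P n (refl beta).
Proof.
move: beta; apply: below_ind => beta Pb IH; have rb := Proot Pb.
have [sb|nsb] := pselect (simple_roots P beta).
  by exists 1%N; apply: simple_word_refl.
have [alpha sa acute] := acute_simple Pb.
have ra := simple_root sa.
have ba : beta <> alpha by move=> ba; apply: nsb; rewrite ba.
have Pb' := simple_refl_positive sa Pb ba.
have [|n wn] := IH _ Pb'.
  have [c [cE -> _ _]] := root_pairing gS tC ra rb.
  rewrite cE pairing_gt0 // in acute.
  case: c acute {cE} => // n n0; exists (nseq n alpha); split.
  - by case: n n0.
  - by move=> delta /nseqP[-> _]; case: sa.
  by rewrite big_nseq -Monoid.iteropE /= -pmulrn subrK.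
exists (1 + (n + 1))%N.
have -> : refl beta =
    (refl alpha \o (refl (dual_act (refl alpha) beta) \o refl alpha))%VF.
  rewrite comp_lfunA (refl_conj (weyl_refl gS tC ra) (Proot Pb')).
  rewrite (dual_reflK gS tC) //.
  by apply/lfunP => x; rewrite !comp_lfunE (reflK gS tC).
by do 2?[apply: simple_word_cat] => //; apply: simple_word_refl.
Qed.

Lemma weyl_simple_word w : weyl_group w -> exists n, simple_word P n w.
Proof.
elim=> [|alpha s {}w ra sE _ [n wn]]; first by exists 0%N; apply: simple_word_nil.
have [m sm] : exists m, simple_word P m (refl alpha).
  have [/refl_simple_word//|/(PnegN ra)/refl_simple_word] := pselect (P alpha).
  by rewrite (reflN gS tC).
exists (m + n)%N; rewrite (is_reflectionP gS tC ra sE).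
exact: simple_word_cat.
Qed.

(** The first letter, counted from the right, that turns the image of alpha
    negative is the reflection in that image, so it can be moved to the right
    end, where it cancels s_alpha. *)
Lemma exchange n w alpha : simple_word P n w -> simple_roots P alpha ->
  ~ P (dual_act w alpha) ->
  exists2 m, n = m.+1 & simple_word P m (w \o refl alpha)%VF.
Proof.
move=> wn sa; have ra := simple_root sa.
elim: wn => [|k beta s {}w sb sE wk IH].
  by rewrite (dual_act1 gS tC); case: (sa).
have rb := simple_root sb; have wW := simple_word_weyl wk.
have rW := weyl_refl gS tC rb; have sR := is_reflectionP gS tC rb sE.
rewrite sR (dual_act_comp gS tC _ rW wW) => nP; exists k; first by [].
have [Pw|nPw] := pselect (P (dual_act w alpha)).
  have wb : dual_act w alpha = beta.
    by apply: contrapT => wb; apply: nP; apply: simple_refl_positive.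
  rewrite -comp_lfunA (refl_conj wW ra) wb comp_lfunA.
  have -> : (refl beta \o refl beta)%VF = \1%VF.
    by apply/lfunP => x; rewrite comp_lfunE id_lfunE (reflK gS tC).
  by rewrite comp_lfun1l.
have [m -> wm] := IH nPw.
rewrite -comp_lfunA; apply: (simple_word_cons sb) => //.
exact: refl_is_reflection.
Qed.

Lemma simple_word_rcons n w : simple_word P n.+1 w ->
  exists v alpha, [/\ simple_roots P alpha, simple_word P n v &
    w = (v \o refl alpha)%VF].
Proof.
elim: n w => [|n IH] w wn; inversion wn as [|k alpha s u sa sE uk kE wE].
  inversion uk; exists \1%VF, alpha; split=> //; first exact: simple_word_nil.
  rewrite comp_lfun1l comp_lfun1r.
  by apply: (is_reflectionP gS tC) sE; apply: simple_root.
have [v [beta [sb vn ->]]] := IH _ uk.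
exists (s \o v)%VF, beta; split=> //; last by rewrite comp_lfunA.
exact: (simple_word_cons sa sE).
Qed.

(** Write w = v s_alpha.  As w alpha is positive, v alpha is negative, so by
    [exchange] the word of w can be shortened by two letters. *)
Lemma positive_stable_trivial w : weyl_group w ->
  (forall gamma, P gamma -> P (dual_act w gamma)) -> w = \1%VF.
Proof.
move=> /weyl_simple_word[n]; have [N] := ubnP n; elim: N n w => // N IH [|n] w nN.
  by move=> w0 _; inversion w0.
move=> /simple_word_rcons[v [alpha [sa vn wE]]] wP.
have ra := simple_root sa; have vW := simple_word_weyl vn.
have [|m nE wm] := exchange vn sa.
  move=> Pv; apply: (Popp Pv); rewrite -dual_actN -(dual_refl_self gS tC ra).
  rewrite -(dual_act_comp gS tC _ vW (weyl_refl gS tC ra)).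
  by rewrite -wE; apply: wP; case: sa.
rewrite -wE in wm; apply: (IH m) => //; lia.
Qed.

Definition positive_list : seq D :=
  [seq gamma <- undup (sval (cid (roots_finite tC))) | `[< P gamma >]].

Lemma positive_listP gamma : reflect (P gamma) (gamma \in positive_list).
Proof.
rewrite mem_filter mem_undup; apply: (iffP andP) => [[/asboolP]//|Pg].
by split; [apply/asboolP | case: cid => s sP /=; apply/sP/Proot].
Qed.

Lemma positive_list_uniq : uniq positive_list.
Proof. by rewrite filter_uniq // undup_uniq. Qed.

(** An enumeration of the inversion set, so that it can be counted. *)
Definition inversions w : seq D :=
  [seq gamma <- positive_list | `[< P (- dual_act w gamma) >]].

Lemma inversionsP w gamma :
  reflect (inversion_set P w gamma) (gamma \in inversions w).
Proof.
rewrite mem_filter.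
apply: (iffP andP) => [[/asboolP Pw /positive_listP Pg]|[Pg Pw]]; split=> //.
  exact/asboolP.
exact/positive_listP.
Qed.

Lemma inversions_uniq w : uniq (inversions w).
Proof. by rewrite filter_uniq // positive_list_uniq. Qed.

(** A simple reflection on the left changes the sign of only one further root,
    w^-1 alpha. *)
Lemma inversions_le_length n w : simple_word P n w -> (size (inversions w) <= n)%N.
Proof.
elim=> [|k alpha s {}w sa sE wk IH].
  rewrite leqn0 size_eq0; apply/eqP; case E : (inversions _) => [//|gamma l].
  have : gamma \in inversions \1%VF by rewrite E mem_head.
  by move/inversionsP => [Pg]; rewrite /negative_roots /= (dual_act1 gS tC) => /(Popp Pg).
have ra := simple_root sa; have wW := simple_word_weyl wk.
have rW := weyl_refl gS tC ra.
rewrite (is_reflectionP gS tC ra sE).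
have {}IH : (size (dual_act (w^-1)%VF alpha :: inversions w) <= k.+1)%N := IH.
apply: (leq_trans _ IH).
apply: uniq_leq_size; first exact: inversions_uniq.
move=> gamma /inversionsP[Pg].
rewrite /negative_roots /= (dual_act_comp gS tC _ rW wW) => neg.
have [Pw|nPw] := pselect (P (dual_act w gamma)).
  rewrite in_cons (_ : gamma == _) //; apply/eqP.
  rewrite -(dual_actK gS tC gamma wW); congr dual_act.
  apply: contrapT => wa; apply: (Popp _ neg).
  exact: simple_refl_positive.
rewrite in_cons; apply/orP; right; apply/inversionsP; split; first exact: Pg.
by apply: PnegN nPw; apply: weyl_root => //; apply: Proot.
Qed.

(** If w alpha is negative, s_alpha maps the inversions of w s_alpha injectively
    to the inversions of w other than alpha. *)
Lemma inversions_simple_drop w alpha : weyl_group w -> simple_roots P alpha ->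
  ~ P (dual_act w alpha) ->
  (size (inversions (w \o refl alpha)%VF) < size (inversions w))%N.
Proof.
move=> wW sa nP; have ra := simple_root sa; have rW := weyl_refl gS tC ra.
have Pa : P alpha by case: sa.
have nw : P (- dual_act w alpha) by apply: PnegN nP; apply: weyl_root.
pose f := dual_act (refl alpha).
have fK : involutive f := dual_reflK gS tC ra.
have wf gamma : dual_act (w \o refl alpha)%VF gamma = dual_act w (f gamma).
  exact: (dual_act_comp gS tC _ wW rW).
have -> : (size (inversions (w \o refl alpha)%VF)).+1 =
    size (alpha :: map f (inversions (w \o refl alpha)%VF)) by rewrite /= size_map.
have inv_f gamma : gamma \in inversions (w \o refl alpha)%VF ->
    P (f gamma) /\ P (- dual_act w (f gamma)).
  move/inversionsP => [Pg]; rewrite /negative_roots /= wf => neg; split=> //.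
  apply: simple_refl_positive => // ga; rewrite ga /f (dual_refl_self gS tC ra) in neg.
  by rewrite dual_actN opprK in neg.
apply: uniq_leq_size; last first.
  move=> delta; rewrite in_cons => /orP[/eqP ->|/mapP[gamma /inv_f Pf ->]].
    exact: (introT (inversionsP w alpha) (conj Pa nw)).
  exact: (introT (inversionsP w (f gamma)) Pf).
rewrite cons_uniq map_inj_uniq ?inversions_uniq ?andbT; last exact: inv_inj.
apply/negP => /mapP[gamma gi aE].
have gE : gamma = - alpha.
  by rewrite -[LHS]fK -aE; exact: (dual_refl_self gS tC ra).
by move: gi => /inversionsP[Pg _]; rewrite gE in Pg; case: (Popp Pa).
Qed.

(** As long as some w alpha with alpha simple is negative, s_alpha can be split
    off on the right; at the end no simple root, hence no positive root, is
    inverted. *)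
Lemma inversions_word w : weyl_group w -> simple_word P (size (inversions w)) w.
Proof.
have [n] := ubnP (size (inversions w)); elim: n w => // n IH w wn wW.
have [[alpha [sa nP]]|H] :=
    pselect (exists alpha, simple_roots P alpha /\ ~ P (dual_act w alpha)).
  have ra := simple_root sa; have rW := weyl_refl gS tC ra.
  have lt := inversions_simple_drop wW sa nP.
  have w'W := weyl_comp wW rW.
  have wW' := IH _ (leq_trans lt wn) w'W.
  have wE : w = ((w \o refl alpha) \o refl alpha)%VF.
    by apply/lfunP => x; rewrite !comp_lfunE (reflK gS tC).
  have ww := simple_word_cat wW' (simple_word_refl sa); rewrite -wE in ww.
  suff <- : (size (inversions (w \o refl alpha)%VF) + 1)%N = size (inversions w) by [].
  by apply/eqP; rewrite eqn_leq (inversions_le_length ww) addn1 lt.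
have wP gamma : P gamma -> P (dual_act w gamma).
  move: gamma; apply: positive_ind => [alpha sa|beta gamma Pb Pg Pbg wb wg].
    by apply: contrapT => nP; apply: H; exists alpha.
  rewrite dual_actD; apply: PD => //; rewrite -dual_actD.
  by apply: weyl_root => //; apply: Proot.
have w1 := positive_stable_trivial wW wP.
suff -> : size (inversions w) = 0%N by rewrite w1; apply: simple_word_nil.
apply/eqP; rewrite -leqn0; apply: inversions_le_length.
by rewrite w1; apply: simple_word_nil.
Qed.

Lemma has_length_inversions w : weyl_group w -> has_length P w (size (inversions w)).
Proof.
move=> wW; split=> [|m wm]; first exact: inversions_word.
exact: inversions_le_length.
Qed.

Lemma has_length_unique w n : weyl_group w -> has_length P w n ->
  n = size (inversions w).
Proof.
move=> wW [wn min]; apply/eqP; rewrite eqn_leq min ?inversions_le_length //.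
exact: inversions_word.
Qed.

(** If u and w invert the same roots, then w u^-1 preserves the positive
    roots. *)
Lemma inversion_set_inj u w : weyl_group u -> weyl_group w ->
  inversion_set P u = inversion_set P w -> u = w.
Proof.
move=> uW wW uw; have vW := weylV gS tC uW.
suff v1 : (w \o u^-1)%VF = \1%VF.
  apply/lfunP => x; move/lfunP/(_ (u x)): v1.
  by rewrite comp_lfunE id_lfunE (weylK gS tC).
apply: positive_stable_trivial; first exact: (weyl_comp).
move=> gamma Pg; rewrite (dual_act_comp gS tC _ wW vW).
set delta := dual_act _ gamma.
have rd : roots delta := weyl_root vW (Proot Pg).
have ud : dual_act u delta = gamma := dual_actVK gS tC gamma uW.
have rwd : roots (dual_act w delta) := weyl_root wW rd.
have [Pd|nPd] := pselect (P delta); apply: contrapT => nPw.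
  have wd : inversion_set P w delta := conj Pd (PnegN rwd nPw).
  by move: wd; rewrite -uw => -[_]; rewrite /negative_roots /= ud => /(Popp Pg).
have wud : P (- dual_act u (- delta)) by rewrite dual_actN opprK ud.
have ind : inversion_set P u (- delta) := conj (PnegN rd nPd) wud.
move: ind; rewrite uw => -[_]; rewrite /negative_roots /= dual_actN opprK.
exact: nPw.
Qed.

(** * Inversion sets and antidominance *)

Definition positive_at z : set D := [set gamma | P gamma /\ 0 < gamma z].

(** Induction on the number of positive roots that are positive at z, replacing
    z by s_alpha z for a simple alpha with alpha(z) > 0. *)
Lemma exists_inversion_set z : (forall gamma, roots gamma -> gamma z \is Num.real) ->
  exists2 w, weyl_group w & inversion_set P w = positive_at z.
Proof.
pose m z := count (fun gamma : D => `[< 0 < gamma z >]) (positive_list).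
have [n] := ubnP (m z); elim: n z => // n IH z mz zR.
have [[alpha [sa az]]|H] :=
    pselect (exists alpha, simple_roots P alpha /\ 0 < alpha z); last first.
  exists \1%VF; first exact: weyl_one.
  apply/seteqP; split=> gamma [Pg].
    by rewrite /negative_roots /= (dual_act1 gS tC) => /(Popp Pg).
  move=> gz; suff : gamma z <= 0 by move/(lt_le_trans gz); rewrite ltxx.
  apply: (positive_le0 _ Pg) => alpha sa.
  rewrite real_leNgt ?real0 //; last by apply/zR/(simple_root).
  by apply/negP => az; apply: H; exists alpha.
have ra := simple_root sa; have rW := weyl_refl gS tC ra.
have Pa : P alpha by case: sa.
pose f := dual_act (refl alpha).
have fK : involutive f := dual_reflK gS tC ra.
pose z' := refl alpha z.
have fz gamma : f gamma z = gamma z' by apply: (refl_eval gS tC).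
have az' : alpha z' = - alpha z.
  by rewrite -fz /f (dual_refl_self gS tC) // opp_lfunE.
have faN : f alpha = - alpha := dual_refl_self gS tC ra.
have fP gamma : P gamma -> gamma <> alpha -> P (f gamma).
  exact: simple_refl_positive.
have [||w' w'W w'E] := IH z'.
- apply: leq_trans (_ : (m z <= n)%N) => //.
  rewrite /m -!size_filter.
  set A := [seq _ <- _ | _]; set B := [seq _ <- _ | _].
  have AP gamma : gamma \in A -> [/\ P gamma, P (f gamma) & 0 < f gamma z].
    rewrite mem_filter fz => /andP[/asboolP gz /(positive_listP) Pg].
    split=> //; apply: fP => // ga; move: gz; rewrite ga az' oppr_gt0.
    by move/lt_trans => /(_ _ az); rewrite ltxx.
  have BP gamma : P gamma -> 0 < gamma z -> gamma \in B.
    move=> Pg gz; rewrite mem_filter; apply/andP; split; first exact/asboolP.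
    exact/(positive_listP).
  rewrite -(size_map f A) -/(size (alpha :: map f A)).
  apply: uniq_leq_size.
    rewrite cons_uniq map_inj_uniq ?(filter_uniq _ (positive_list_uniq)) ?andbT.
      apply/negP => /mapP[gamma /AP[Pg _ _] aE].
      by have gE : gamma = - alpha; [rewrite -faN aE fK | case: (Popp Pa); rewrite -gE].
    exact: (inv_inj fK).
  move=> gamma; rewrite in_cons => /orP[/eqP -> |/mapP[delta /AP[_ P1 P2] ->]].
    exact: (BP _ Pa az).
  exact: (BP _ P1 P2).
- by move=> gamma rg; rewrite -fz; apply/zR/(refl_root gS tC).
exists (w' \o refl alpha)%VF; first exact: weyl_comp.
have wf gamma : dual_act (w' \o refl alpha)%VF gamma = dual_act w' (f gamma).
  exact: (dual_act_comp gS tC _ w'W rW).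
have key gamma : P gamma -> P (- dual_act w' gamma) <-> 0 < gamma z'.
  move=> Pg; split=> [Pw|gz].
    by have : inversion_set P w' gamma by []; rewrite w'E => -[].
  by have : positive_at z' gamma by []; rewrite -w'E => -[].
apply/seteqP; split=> gamma [Pg].
  rewrite /negative_roots /= wf => neg; split; first exact: Pg.
  have [->//|/eqP ga] := eqVneq gamma alpha.
  by have := (key _ (fP _ Pg ga)).1 neg; rewrite -fz fK.
move=> gz; split; first exact: Pg.
rewrite /negative_roots /= wf.
have [ga|/eqP ga] := eqVneq gamma alpha.
  rewrite ga faN dual_actN opprK; apply: contrapT => nPw.
  have := (key _ Pa).1 (PnegN (weyl_root w'W ra) nPw).
  by rewrite az' oppr_gt0 => /lt_trans/(_ az); rewrite ltxx.
by apply: (key _ (fP _ Pg ga)).2; rewrite -fz fK.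
Qed.

Lemma dominant_positive x : dominant_chamber P x -> forall beta, P beta -> 0 <= beta x.
Proof.
move=> [_ xs] beta Pb.
have H alpha : simple_roots P alpha -> alpha (- x) <= 0.
  by move=> sa; rewrite linearN oppr_le0; apply: xs.
by have := positive_le0 H Pb; rewrite linearN oppr_le0.
Qed.

(** The root w gamma is positive at w z, where positive roots are
    nonpositive. *)
Lemma takes_antidominant_inversions z w : takes_antidominant P z w ->
  positive_at z `<=` inversion_set P w.
Proof.
move=> [wW wA] gamma [Pg gz]; split=> //.
apply: (PnegN (weyl_root wW (Proot Pg))) => Pw.
have := dominant_positive wA Pw; rewrite linearN /= (dual_act_eval gS tC) //.
by rewrite oppr_ge0 => /(lt_le_trans gz); rewrite ltxx.
Qed.

(** The values of simple roots at w z are the values at z of the roots w^-1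
    alpha, whose sign is known both when they are positive and when they are
    negative. *)
Lemma inversion_set_antidominant z w : rational_form z -> weyl_group w ->
  inversion_set P w = positive_at z -> antidominant P (w z).
Proof.
move=> zQ wW wE.
have vW := weylV gS tC wW.
have rv alpha : roots alpha -> roots (dual_act (w^-1)%VF alpha).
  by move=> ra; apply: (weyl_root).
have eval alpha : alpha (- (w z)) = - dual_act (w^-1)%VF alpha z.
  by rewrite linearN (dual_actV_eval gS tC).
split=> [alpha ra|alpha sa].
  have [q qE] := zQ _ (rv _ ra); exists (- q).
  by rewrite eval qE rmorphN.
have Pa : P alpha by case: sa.
have ra := Proot Pa; rewrite eval.
set beta := dual_act _ alpha.
have rb : roots beta := rv _ ra.
have wb : dual_act w beta = alpha by apply: (dual_actVK gS tC).
have bR : beta z \is Num.real.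
  by have [q ->] := zQ _ rb; rewrite realE ler0q lerq0 le_total.
have [Pb|nPb] := pselect (P beta).
  rewrite oppr_ge0 real_leNgt ?real0 //; apply/negP => bz.
  have : positive_at z beta by [].
  by rewrite -wE => -[_]; rewrite /negative_roots /= wb => /(Popp Pa).
have : inversion_set P w (- beta).
  by split; [apply: PnegN | rewrite /negative_roots /= dual_actN opprK wb].
by rewrite wE => -[_]; rewrite opp_lfunE; apply: ltW.
Qed.

End Positive.

Theorem proposition6p3 (R : realType) (g : lieAlgebra R[i]) (t : {vspace g})
    (P : set (tdual t)) (z : subvs_of t) :
  lie_simple g -> cartan_subalgebra t -> positive_system P ->
  rational_form z ->
  (forall gamma, P gamma -> gamma z \in [:: -1; 0; 1; 2]) ->
  (exists! w, is_wz P z w) /\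
  (forall w, is_wz P z w ->
     antidominant P (w z) /\ unique (minimal_antidominant P z) w).
Proof.
move=> gS tC PS zQ zP.
have zR gamma : roots gamma -> gamma z \is Num.real.
  by move=> rg; have [q ->] := zQ _ rg; rewrite realE ler0q lerq0 le_total.
have levelE : level P z 1 `|` level P z 2 = positive_at P z.
  apply/seteqP; split=> gamma.
    by case=> -[Pg /= gz]; split=> //; rewrite gz ?ltr01 ?ltr0n.
  move=> [Pg gz]; have := zP _ Pg; rewrite !inE => /or4P[] /eqP gE.
  - by move: gz; rewrite gE ltr0N1.
  - by move: gz; rewrite gE ltxx.
  - by left.
  - by right.
have wzE w : is_wz P z w <-> weyl_group w /\ inversion_set P w = positive_at P z.
  by rewrite /is_wz levelE.
have [w0 w0W w0E] := exists_inversion_set gS tC PS zR.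
have w0u w : is_wz P z w -> w0 = w.
  move=> /wzE[wW wE].
  exact: (inversion_set_inj gS tC PS w0W wW (etrans w0E (esym wE))).
split; first by exists w0; split; [exact: ((wzE w0).2 (conj w0W w0E)) | exact: w0u].
move=> w wz; rewrite -(w0u _ wz) => {w wz}.
have w0A : antidominant P (w0 z).
  exact: (inversion_set_antidominant gS tC PS zQ w0W w0E).
split=> //.
have le_w w : takes_antidominant P z w ->
    {subset inversions tC P w0 <= inversions tC P w}.
  move=> wA gamma /(inversionsP tC PS); rewrite w0E => gz.
  exact/(inversionsP tC PS)/(takes_antidominant_inversions gS tC PS wA).
split.
  split=> //; exists (size (inversions tC P w0)).
    exact: (has_length_inversions gS tC PS).
  move=> w n wA wn; have [wW _] := wA.
  rewrite (has_length_unique gS tC PS wW wn).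
  apply: uniq_leq_size; [exact: inversions_uniq | exact: le_w].
move=> w [wA [n wn min]]; have [wW _] := wA.
apply: (inversion_set_inj gS tC PS w0W wW).
have := min _ _ (conj w0W w0A) (has_length_inversions gS tC PS w0W).
rewrite (has_length_unique gS tC PS wW wn) => sz.
have [_ eqw] := uniq_min_size (inversions_uniq tC P w0) (le_w _ wA) sz.
apply/seteqP; split=> gamma.
  by move/(inversionsP tC PS); rewrite eqw => /(inversionsP tC PS).
by move/(inversionsP tC PS); rewrite -eqw => /(inversionsP tC PS).
Qed.
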